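(* Let $\alpha>1$, let $H$ be a Hilbert space and let $T\in B(H)$ be an $\alpha$-Ritt operator. If $T$ is strongly Kreiss bounded, then there exists $\kappa>0$ such that for each $k\in\mathbb{N}$, $$\|T^n(I-T)^k\| = O\Big(\frac{\log^{\kappa}(n+1)}{n^{k/\alpha}}\Big).$$
   Context: Spaces are complex; $\mathbb{N}=\{1,2,\dots\}$; $B(H)$ is the algebra of bounded linear operators on $H$; $\mathbb{D}$ is the open unit disk; $\sigma(T)$ is the spectrum and $R(\lambda,T)=(\lambda I-T)^{-1}$ for $\lambda\notin\sigma(T)$. For $\alpha>1$, $T$ is $\alpha$-Ritt if $\sigma(T)\subset\overline{\mathbb{D}}$ and there is $C>0$ with $\|R(\lambda,T)\|\le \frac{C}{|\lambda-1|^{\alpha}}$ for all $1<|\lambda|<2$. $T$ is strongly Kreiss bounded if $\sigma(T)\subset\overline{\mathbb{D}}$ and there is $C>0$ with $\|R(\lambda,T)^n\|\le \frac{C}{(|\lambda|-1)^n}$ for all $|\lambda|>1$ and $n\in\mathbb{N}$. For nonnegative sequences, $a_n=O(b_n)$ means there is $C>0$ with $a_n\le C b_n$ for all $n\ge1$. $\log^{\kappa}(n+1)$ means $(\log(n+1))^{\kappa}$. *)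

(* Defs.v *)
From HB Require Import structures.
From mathcomp Require Import all_boot all_order all_algebra.
From mathcomp Require Import complex.
From mathcomp Require Import all_classical all_reals all_analysis.

Set Implicit Arguments.
Unset Strict Implicit.
Unset Printing Implicit Defensive.

Import Order.TTheory GRing.Theory Num.Theory.
Import numFieldNormedType.Exports.

Local Open Scope classical_set_scope.
Local Open Scope complex_scope.
Local Open Scope ring_scope.

Section operators.
Context (R : realType) (H : normedModType R[i]).
Implicit Types (T : H -> H) (l : R[i]).

(* Norms over the scalar field [R[i]] are elements of [R[i]] with zero
   imaginary part; [complex.Re] reads them in [R].  The supremum in [R] is
   meaningful only when it is finite, i.e. for bounded [T]. *)
Definition opnorm T : R :=
  sup [set complex.Re `|T x| | x in [set x : H | `|x| <= 1]].

(* [l] is outside the spectrum iff [l I - T] is invertible in [B(H)]. *)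
Definition resolvent_set T : set R[i] :=
  [set l | exists S : {linear H -> H},
    [/\ bounded_near S (nbhs (0 : H)),
        (forall x, S (l *: x - T x) = x) &
        (forall y, l *: S y - T (S y) = y)]].

Definition spectrum T : set R[i] := ~` resolvent_set T.

(* The inverse function of [l I - T]; junk for [l] in the spectrum. *)
Definition resolvent l T : H -> H :=
  fun y => xget 0 [set x | l *: x - T x = y].

Definition closed_unit_disk : set R[i] := [set l | `|l| <= 1].

Definition alpha_Ritt (alpha : R) T : Prop :=
  spectrum T `<=` closed_unit_disk /\
  exists2 C : R, 0 < C & forall l, 1 < `|l| -> `|l| < 2 ->
    opnorm (resolvent l T) <= C / (complex.Re `|l - 1|) `^ alpha.

Definition strongly_Kreiss_bounded T : Prop :=
  spectrum T `<=` closed_unit_disk /\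
  exists2 C : R, 0 < C & forall l n, 1 < `|l| -> (0 < n)%N ->
    opnorm (iter n (resolvent l T)) <= C / (complex.Re `|l| - 1) ^+ n.

End operators.

Definition seq_bigO (R : realType) (a b : nat -> R) : Prop :=
  exists2 C : R, 0 < C & forall n, (0 < n)%N -> a n <= C * b n.

(* Main.v *)
(* Write T_w = w T for |w| = 1. All estimates use finite sums and the discrete
   Parseval identity over roots of unity, applied to vectors p(T_w) x.

   Growth. The Kreiss condition at |l| = 1/s bounds ((1 - s) / (1 - s T_w))^m
   uniformly in m and w, i.e. averages of the T_w^j against negative binomial
   laws; taking s small makes the Neumann series trivially convergent. By
   Parseval, convolution by such a law of mean n and deviation sqrt n is bounded
   on l^2(H). Convolving with an interval of length about sqrt n transfers
   square-function bounds for T^j (columns x |-> (T^j x)_j and rows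
   (u_j)_j |-> sum T^j u_j) from [0, sqrt N] to [0, N] at a constant cost.
   Iterating log log N times and pairing rows with columns gives
   |T^n| = O(log^kappa n).

   Decay. Let G = 1 + 'X + ... + 'X^(N-1) with N of order n. In the expansion of
   w^k (I - T)^k G(T_w)^(k+1) in powers of w - 1 and I - T_w, each factor
   I - T_w turns a G into 1 - 'X^N, which gains 1/N, while the Ritt condition
   lets a factor w - 1 gain N^(-1/alpha): trivially if |w - 1| is smaller than
   that, and otherwise by bounding the vector through (I - T_w)^i. Summing over
   w bounds the l^2 norm of T^j (I - T)^k x weighted by the coefficients of
   G^(k+1), and the total mass N^(k+1) of these weights recovers T^n (I - T)^k x.
   Only two factors |T^j| are used, so kappa does not depend on k. *)
Require Import Defs.
From HB Require Import structures.
From mathcomp Require Import all_boot all_order all_algebra.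
From mathcomp Require Import complex.
From mathcomp Require Import all_classical all_reals all_analysis.
From mathcomp Require Import cyclic separable cyclotomic.
From mathcomp Require Import zify ring lra.

Set Implicit Arguments.
Unset Strict Implicit.
Unset Printing Implicit Defensive.

Import Order.TTheory GRing.Theory Num.Theory.
Import numFieldNormedType.Exports.

Local Open Scope classical_set_scope.
Local Open Scope complex_scope.
Local Open Scope ring_scope.

(** * Norms in the reals *)

Section RealNorm.
Context (R : realType).
Definition rnorm (V : normedZmodType R[i]) (x : V) : R := complex.Re `|x|.

Lemma rnormE (V : normedZmodType R[i]) (x : V) : `|x| = (rnorm x)%:C.
Proof. by rewrite /rnorm RRe_real // normr_real. Qed.

Lemma rnorm_ge0 (V : normedZmodType R[i]) (x : V) : 0 <= rnorm x.
Proof. by rewrite -ler0c -rnormE. Qed.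

Lemma rnorm0 (V : normedZmodType R[i]) : rnorm (0 : V) = 0.
Proof. by rewrite /rnorm normr0. Qed.

Lemma rnormN (V : normedZmodType R[i]) (x : V) : rnorm (- x) = rnorm x.
Proof. by rewrite /rnorm normrN. Qed.

Lemma ler_rnormD (V : normedZmodType R[i]) (x y : V) :
  rnorm (x + y) <= rnorm x + rnorm y.
Proof. by rewrite -lecR rmorphD /= -!rnormE; exact: ler_normD. Qed.

Lemma ler_rnorm_sum (V : normedZmodType R[i]) I r (P : pred I) (F : I -> V) :
  rnorm (\sum_(i <- r | P i) F i) <= \sum_(i <- r | P i) rnorm (F i).
Proof.
elim/big_ind2: _ => // [|x a y b xa yb]; first by rewrite rnorm0.
by rewrite (le_trans (ler_rnormD _ _)) ?lerD.
Qed.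

Lemma rnormZ (V : normedModType R[i]) (c : R[i]) (x : V) :
  rnorm (c *: x) = rnorm c * rnorm x.
Proof. by apply: (@complexI R); rewrite rmorphM /= -!rnormE normrZ. Qed.

Lemma rnormM (c d : R[i]) : rnorm (c * d) = rnorm c * rnorm d.
Proof. by apply: (@complexI R); rewrite rmorphM /= -!rnormE normrM. Qed.

Lemma rnormX (c : R[i]) n : rnorm (c ^+ n) = rnorm c ^+ n.
Proof. by apply: (@complexI R); rewrite rmorphXn /= -!rnormE normrX. Qed.

Lemma rnorm1 : rnorm (1 : R[i]) = 1.
Proof. by rewrite /rnorm normr1. Qed.

Lemma rnorm_real (a : R) : rnorm (a%:C) = `|a|.
Proof. by rewrite /rnorm normc_def /= expr0n addr0 sqrtr_sqr. Qed.

Lemma rnorm_nat n : rnorm (n%:R : R[i]) = n%:R.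
Proof. by rewrite -(rmorph_nat (real_complex R)) rnorm_real normr_nat. Qed.
End RealNorm.

Section Opnorm.
Context (R : realType) (H : normedModType R[i]).

Lemma linear_rnorm_bound (S : {linear H -> H}) :
  bounded_near S (nbhs (0 : H)) ->
  exists2 K : R, 0 < K & forall x, rnorm (S x) <= K * rnorm x.
Proof.
move=> /linear_boundedP /pinfty_ex_gt0 [r r0 Sr].
have rE : r = (complex.Re r)%:C by rewrite RRe_real ?gtr0_real.
exists (complex.Re r) => [|x]; first by rewrite -ltcR -rE.
by rewrite -lecR rmorphM /= -rE -!rnormE.
Qed.

(** Normalising [x] uses a positive real scalar, so real homogeneity suffices. The bound by [K]
    makes the supremum in [opnorm] finite, hence meaningful. *)
Lemma opnorm_ge (S : H -> H) (K : R) :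
  (forall (a : R) x, S (a%:C *: x) = a%:C *: S x) ->
  (forall x, rnorm (S x) <= K * rnorm x) ->
  forall x, rnorm (S x) <= opnorm S * rnorm x.
Proof.
move=> SZ SK x.
have [x0|x0] := eqVneq (rnorm x) 0.
  by rewrite x0 mulr0; have := SK x; rewrite x0 mulr0.
have xp : 0 < rnorm x by rewrite lt_def x0 rnorm_ge0.
pose y := ((rnorm x)^-1)%:C *: x.
have ny : rnorm y = 1.
  by rewrite rnormZ rnorm_real ger0_norm ?invr_ge0 ?rnorm_ge0// mulVf.
have -> : rnorm (S x) = rnorm (S y) * rnorm x.
  rewrite SZ rnormZ rnorm_real ger0_norm ?invr_ge0 ?rnorm_ge0//.
  by rewrite mulrC mulrA mulfV// mul1r.
rewrite ler_wpM2r ?rnorm_ge0// /opnorm; apply: ub_le_sup; last first.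
  by exists y => //=; rewrite rnormE ny.
exists `|K| => _ /= [z + <-]; rewrite rnormE lecR => z1.
rewrite (le_trans (SK z))// (le_trans (ler_wpM2r (rnorm_ge0 _) (ler_norm K)))//.
by rewrite ler_piMr.
Qed.

Lemma opnorm_le (S : H -> H) (c : R) : 0 <= c ->
  (forall x, rnorm (S x) <= c * rnorm x) -> opnorm S <= c.
Proof.
move=> c0 Sc; apply: ge_sup; first by exists (complex.Re `|S 0|), 0 => //=; rewrite normr0.
move=> _ [z /= + <-]; rewrite rnormE lecR => z1.
by rewrite (le_trans (Sc z))// ler_piMr.
Qed.
End Opnorm.

(** In characteristic 0 the polynomial ['X^n - 1] is separable, so it has [n] distinct roots, and
    among [n] distinct [n]-th roots of unity one is primitive. *)
Lemma prim_root_exists (C : numClosedFieldType) n : (0 < n)%N ->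
  exists z : C, n.-primitive_root z.
Proof.
move=> n0; have [r] := closed_field_poly_normal ('X^n - 1 : {poly C}).
rewrite (monicP (monicXnsubC _ n0)) scale1r => rE.
have ur : uniq r.
  by rewrite -separable_prod_XsubC -rE separable_Xn_sub_1// pnatr_eq0 -lt0n.
have r1 : all n.-unity_root r.
  by apply/allP => z; rewrite -root_prod_XsubC -rE.
have sr : (n <= size r)%N.
  by rewrite -ltnS -(size_prod_XsubC r id) -rE size_XnsubC.
by have /hasP[z _ zn] := has_prim_root n0 r1 ur sr; exists z.
Qed.

(** * Polynomials in an operator *)

Section PolyAction.
Context (F : comNzRingType) (V : lmodType F) (T : {linear V -> V}).
Implicit Types (p q : {poly F}) (x y : V) (c : F).

Definition pact p x := \sum_(i < size p) p`_i *: iter i T x.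

Lemma iter0l i : iter i T 0 = 0.
Proof. by elim: i => //= i ->; rewrite linear0. Qed.

Lemma iterDl i x y : iter i T (x + y) = iter i T x + iter i T y.
Proof. by elim: i => //= i ->; rewrite linearD. Qed.

Lemma iterZl i c x : iter i T (c *: x) = c *: iter i T x.
Proof. by elim: i => //= i ->; rewrite linearZ. Qed.

Lemma iter_suml i I (r : seq I) (P : pred I) (f : I -> V) :
  iter i T (\sum_(j <- r | P j) f j) = \sum_(j <- r | P j) iter i T (f j).
Proof.
elim/big_rec2: _ => [|j y x _ <-]; [exact: iter0l|exact: iterDl].
Qed.

Lemma pactE n p x : (size p <= n)%N ->
  pact p x = \sum_(i < n) p`_i *: iter i T x.
Proof.
move=> pn; rewrite /pact (big_ord_widen n (fun i => p`_i *: iter i T x))//.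
rewrite big_mkcond; apply: eq_bigr => i _; case: ltnP => // pi.
by rewrite nth_default// scale0r.
Qed.

Lemma pactD p q x : pact (p + q) x = pact p x + pact q x.
Proof.
pose n := maxn (size p) (size q).
rewrite !(@pactE n) ?leq_maxl ?leq_maxr ?size_polyD//.
by rewrite -big_split; apply: eq_bigr => i _; rewrite coefD scalerDl.
Qed.

Lemma pactZ c p x : pact (c *: p) x = c *: pact p x.
Proof.
rewrite !(@pactE (size p)) ?size_scale_leq// scaler_sumr.
by apply: eq_bigr => i _; rewrite coefZ scalerA.
Qed.

Lemma pact0 x : pact 0 x = 0.
Proof. by rewrite /pact size_poly0 big_ord0. Qed.

Lemma pactC c x : pact c%:P x = c *: x.
Proof. by rewrite (@pactE 1) ?size_polyC_leq1// big_ord1 coefC. Qed.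

Lemma pact1 x : pact 1 x = x.
Proof. by rewrite pactC scale1r. Qed.

Lemma pactMX p x : pact (p * 'X) x = T (pact p x).
Proof.
have sz : (size (p * 'X)%R <= (size p).+1)%N.
  by rewrite (leq_trans (size_polyMleq _ _))// size_polyX addn2.
rewrite (pactE _ sz) big_ord_recl coefMX scale0r add0r /pact linear_sum.
by apply: eq_bigr => i _; rewrite coefMX /= linearZ.
Qed.

Lemma pactM p q x : pact (p * q) x = pact p (pact q x).
Proof.
elim/poly_ind: p => [|p c IH]; first by rewrite mul0r !pact0.
rewrite mulrDl !pactD mul_polyC pactZ pactC; congr (_ + _).
by rewrite mulrAC !pactMX IH.
Qed.

Lemma pact_sum I (r : seq I) (P : pred I) (f : I -> {poly F}) x :
  pact (\sum_(i <- r | P i) f i) x = \sum_(i <- r | P i) pact (f i) x.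
Proof.
by elim/big_rec2: _ => [|i y1 y2 _ <-]; [exact: pact0|exact: pactD].
Qed.

Lemma pactXn i x : pact 'X^i x = iter i T x.
Proof. by elim: i => [|i IH]; rewrite ?pact1// exprSr pactMX IH. Qed.

Lemma pactX x : pact 'X x = T x. Proof. by rewrite -['X]expr1 pactXn. Qed.

Lemma pactZr p c x : pact p (c *: x) = c *: pact p x.
Proof.
rewrite /pact scaler_sumr; apply: eq_bigr => i _.
by rewrite iterZl !scalerA mulrC.
Qed.

Lemma pactN p x : pact (- p) x = - pact p x.
Proof. by rewrite -[RHS]scaleN1r -pactZ scaleN1r. Qed.

Lemma pactB p q x : pact (p - q) x = pact p x - pact q x.
Proof. by rewrite pactD pactN. Qed.

Lemma iter_pact p i x : iter i (pact p) x = pact (p ^+ i) x.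
Proof. by elim: i => [|i IH]; rewrite ?pact1//= IH -pactM -exprS. Qed.

End PolyAction.

(* [pact T (dil w p)] is [p] evaluated at [w T]. *)
Section Dilation.
Context (F : comNzRingType).
Implicit Types (p q : {poly F}) (w c : F).

Definition dil w p := p \Po (w *: 'X).

Lemma dilC w c : dil w c%:P = c%:P. Proof. exact: comp_polyC. Qed.
Lemma dil1 w : dil w 1 = 1. Proof. exact: dilC. Qed.
Lemma dilX w : dil w 'X = w *: 'X. Proof. exact: comp_polyX. Qed.
Lemma dilD w p q : dil w (p + q) = dil w p + dil w q.
Proof. exact: comp_polyD. Qed.
Lemma dilB w p q : dil w (p - q) = dil w p - dil w q.
Proof. exact: comp_polyB. Qed.
Lemma dilM w p q : dil w (p * q) = dil w p * dil w q.
Proof. exact: comp_polyM. Qed.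
Lemma dilXn w p n : dil w (p ^+ n) = dil w p ^+ n.
Proof. by elim: n => [|n IH]; rewrite ?expr0 ?dil1// !exprS dilM IH. Qed.

Lemma dilE n w p : (size p <= n)%N ->
  dil w p = \sum_(i < n) (w ^+ i * p`_i) *: 'X^i.
Proof.
move=> pn; have -> : dil w p = \sum_(i < size p) (w ^+ i * p`_i) *: 'X^i.
  rewrite /dil comp_polyE; apply: eq_bigr => i _.
  by rewrite exprZn scalerA mulrC.
rewrite (big_ord_widen n (fun i => (w ^+ i * p`_i) *: 'X^i))//.
rewrite big_mkcond; apply: eq_bigr => i _; case: ltnP => // pi.
by rewrite nth_default// mulr0 scale0r.
Qed.

Lemma pact_dil (V : lmodType F) (T : {linear V -> V}) n w p x :
  (size p <= n)%N ->
  pact T (dil w p) x = \sum_(i < n) w ^+ i *: (p`_i *: iter i T x).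
Proof.
move=> pn; rewrite (dilE _ pn) pact_sum; apply: eq_bigr => i _.
by rewrite pactZ pactXn scalerA.
Qed.
End Dilation.

(** * Parseval over roots of unity *)

Section Parseval.
Context (R : realType) (H : normedModType R[i]) (dot : {dot H for Num.conj}).
Hypothesis dotE : forall x : H, `|x| ^+ 2 = dot x x.

Lemma rnorm_prim_root n (z : R[i]) : n.-primitive_root z -> rnorm z = 1.
Proof.
move=> zn; have n0 := prim_order_gt0 zn.
have /eqP := congr1 (@rnorm R _) (prim_expr_order zn).
by rewrite rnormX rnorm1 pexpr_eq1 ?rnorm_ge0// => /eqP.
Qed.

(** Orthogonality of characters: for [j != k] the terms are the powers of some [y != 1] with
    [y ^+ M = 1], and their geometric sum vanishes. *)
Lemma sum_prim_root_conj M (z : R[i]) (j k : nat) :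
  M.-primitive_root z -> (j < M)%N -> (k < M)%N ->
  \sum_(t < M) (z ^+ (t * j) * Num.conj (z ^+ (t * k))) =
  if j == k then M%:R else 0.
Proof.
move=> zM jM kM; have zn := rnorm_prim_root zM.
have zz : z * Num.conj z = 1 by rewrite -normCK rnormE zn expr1n.
have [->|jk] := eqVneq j k.
  rewrite -[M in RHS]card_ord -sum1_card natr_sum; apply: eq_bigr => t _.
  by rewrite rmorphXn/= -exprMn zz expr1n.
pose y := z ^+ j * Num.conj z ^+ k.
have y1 : y - 1 != 0.
  rewrite subr_eq0; apply: contra_neq jk => y1.
  have : z ^+ j = z ^+ k.
    rewrite -[LHS]mulr1 -[X in _ * X](expr1n _ k) -zz exprMn mulrCA mulrA.
    by rewrite -mulrA -/y y1 mulr1.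
  by move/eqP; rewrite (eq_prim_root_expr zM) !modn_small// => /eqP.
have yM : y ^+ M = 1.
  rewrite exprMn -!exprM ![(_ * M)%N]mulnC !exprM -rmorphXn/=.
  by rewrite (prim_expr_order zM) rmorph1 !expr1n mulr1.
apply: (mulfI y1); rewrite mulr0 (eq_bigr (fun t : 'I_M => y ^+ t)).
  by rewrite -subrX1 yM subrr.
by move=> t _; rewrite exprMn -!exprM rmorphXn/= ![(t * _)%N]mulnC.
Qed.

Lemma dot_sum M (z : R[i]) (v : nat -> H) t :
  dot (\sum_(j < M) (z ^+ t) ^+ j *: v j) (\sum_(j < M) (z ^+ t) ^+ j *: v j) =
  \sum_(j < M) \sum_(k < M)
    z ^+ (t * j) * Num.conj (z ^+ (t * k)) * dot (v j) (v k).
Proof.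
rewrite linear_sumlz; apply: eq_bigr => j _.
rewrite -[LHS]/(dot _ _) raddf_sum /=; apply: eq_bigr => k _.
by rewrite linearZl_LR /= linearZ_LR /= -!exprM mulrA.
Qed.

(** Expand each square by [dot] and sum over [t] first: orthogonality leaves only the diagonal
    terms. *)
Lemma parseval M (z : R[i]) (v : nat -> H) : M.-primitive_root z ->
  \sum_(t < M) rnorm (\sum_(j < M) (z ^+ t) ^+ j *: v j) ^+ 2 =
  M%:R * \sum_(j < M) rnorm (v j) ^+ 2.
Proof.
move=> zM; apply: (@complexI R); rewrite rmorphM /= !rmorph_sum /=.
have sqE (x : H) : ((rnorm x ^+ 2)%:C = dot x x)%C.
  by rewrite -dotE rnormE -rmorphXn.
under eq_bigr => t _ do rewrite sqE dot_sum.
rewrite exchange_big mulr_sumr; apply: eq_bigr => j _ /=.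
rewrite exchange_big (bigD1 j)//= [X in _ + X]big1 ?addr0 => [|k kj].
  rewrite -mulr_suml sum_prim_root_conj// eqxx sqE.
  by rewrite (rmorph_nat (real_complex R)).
rewrite -mulr_suml sum_prim_root_conj//; case: eqP => [/val_inj jk|_].
  by rewrite jk eqxx in kj.
by rewrite mul0r.
Qed.
End Parseval.

(** * Negative binomial kernels *)

Section GeometricKernel.
Context (R : realType).
Implicit Types (s : R) (p : {poly R}).

(* The generating function of the geometric law [(1 - s) / (1 - s 'X)], with the
   whole mass beyond [L] moved to [L]; its powers are then probability laws that
   approximate [((1 - s) / (1 - s 'X)) ^+ m] without infinite sums. *)
Fixpoint geo s L : {poly R} :=
  if L is L'.+1 then (1 - s)%:P + s%:P * (geo s L' * 'X) else 1.

(** The product telescopes. The truncation leaves an error carrying [(s%:P * 'X) ^+ L], negligible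
    for large [L] once [s T] has norm at most 1/2. *)
Lemma geo_factor s L : (1 - s%:P * 'X) * geo s L =
  (1 - s)%:P + (s%:P * 'X) ^+ L * (s%:P * (1 - 'X)).
Proof.
elim: L => [|L IH] /=; first by rewrite polyCB; ring.
rewrite mulrDr [X in _ + X](_ : _ = s%:P * 'X * ((1 - s%:P * 'X) * geo s L)).
  by rewrite IH exprS polyCB; ring.
by ring.
Qed.

Lemma coefM_ge0 p (q : {poly R}) : (forall i, 0 <= p`_i) -> (forall i, 0 <= q`_i) ->
  forall i, 0 <= (p * q)`_i.
Proof.
by move=> p0 q0 i; rewrite coefM sumr_ge0// => j _; rewrite mulr_ge0.
Qed.

Lemma coefXn_ge0 p n : (forall i, 0 <= p`_i) -> forall i, 0 <= (p ^+ n)`_i.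
Proof.
move=> p0; elim: n => [|n IH] i; first by rewrite coef1 ler0n.
by rewrite exprS coefM_ge0.
Qed.

Lemma coef_geo_ge0 s L : 0 <= s <= 1 -> forall i, 0 <= (geo s L)`_i.
Proof.
move=> /andP[s0 s1]; elim: L => [|L IH] i /=; first by rewrite coef1 ler0n.
rewrite coefD coefC coefCM coefMX addr_ge0//; case: (i == 0)%N => //.
- by rewrite subr_ge0.
- by rewrite mulr0.
- by rewrite mulr_ge0.
Qed.

Definition hornerS :=
  (@horner0 R, @hornerD R, @hornerN R, @hornerM R, @hornerC R, @hornerX R, @hornerZ R,
   @hornerXn R,
   @hornerMn R, @horner_exp R).

Lemma geo_horner1 s L : (geo s L).[1] = 1.
Proof. by elim: L => [|L IH] /=; rewrite !hornerS// IH; ring. Qed.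

(** Derivatives at 1 of a generating function are factorial moments. This is the mean [s / (1 - s)]
    of the geometric law, lowered by the truncation. *)
Lemma geo_deriv1 s L : 0 < s < 1 ->
  (deriv (geo s L)).[1] = s / (1 - s) * (1 - s ^+ L).
Proof.
move=> /andP[s0 s1]; have s1' : 1 - s != 0 by rewrite subr_eq0 gt_eqF.
elim: L => [|L IH] /=; first by rewrite derivC !hornerS subrr mulr0.
by rewrite !poly.derivE !hornerS IH geo_horner1 exprS; field.
Qed.

(** With [m = s / (1 - s)], the value [2 * m ^+ 2] of the full geometric law is the fixed point of
    the recursion in [L], because [s * (1 + m) = m]. *)
Lemma geo_deriv2 s L : 0 < s < 1 ->
  (deriv (deriv (geo s L))).[1] <= 2 * (s / (1 - s)) ^+ 2.
Proof.
move=> /andP[s0 s1]; have s1' : 0 < 1 - s by rewrite subr_gt0.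
elim: L => [|L IH] /=.
  by rewrite !derivC horner0 mulr_ge0 ?exprn_ge0// divr_ge0// ltW.
rewrite !poly.derivE !hornerS geo_deriv1 ?s0//.
set m := s / (1 - s) in IH *.
have m0 : 0 < m by rewrite divr_gt0.
have mE : s * (m + m ^+ 2) = m ^+ 2.
  by rewrite /m; field; rewrite gt_eqF.
rewrite -mE; have : s * ((deriv (deriv (geo s L))).[1]) <= s * (2 * m ^+ 2).
  by rewrite ler_wpM2l// ltW.
have : s * (m * (1 - s ^+ L)) <= s * m.
  by rewrite ler_wpM2l ?ler_piMr ?gerBl ?exprn_ge0// ltW.
lra.
Qed.

Lemma horner1_exp p m : p.[1] = 1 -> (p ^+ m).[1] = 1.
Proof. by move=> p1; rewrite horner_exp p1 expr1n. Qed.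

Lemma deriv1_exp p m : p.[1] = 1 ->
  (deriv (p ^+ m)).[1] = m%:R * (deriv p).[1].
Proof.
move=> p1; elim: m => [|m IH]; first by rewrite derivC horner0 mul0r.
by rewrite exprS !poly.derivE !hornerS IH p1 expr1n -natr1; ring.
Qed.

Lemma deriv2_exp p m : p.[1] = 1 ->
  (deriv (deriv (p ^+ m))).[1] =
  m%:R * (m%:R - 1) * (deriv p).[1] ^+ 2 + m%:R * (deriv (deriv p)).[1].
Proof.
move=> p1; elim: m => [|m IH]; first by rewrite !derivC horner0; ring.
rewrite exprS !poly.derivE !(hornerD, hornerM) IH deriv1_exp// horner1_exp// p1.
by rewrite -natr1; ring.
Qed.

(** Write [(l - c)^2 = l (l - 1) + l - 2 c l + c^2] and read off the factorial moments. *)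
Lemma second_moment p (c : R) :
  \sum_(l < size p) p`_l * (l%:R - c) ^+ 2 =
  (deriv (deriv p)).[1] + (deriv p).[1] - 2 * c * (deriv p).[1] + c ^+ 2 * p.[1].
Proof.
have pE : p = \sum_(i < size p) p`_i *: 'X^i by rewrite -poly_def coefK.
have dE : (deriv p) = \sum_(i < size p) p`_i *: (i%:R *: 'X^(i.-1)).
  rewrite {1}pE raddf_sum; apply: eq_bigr => i _.
  by rewrite /= derivZ derivXn scaler_nat.
have p1 : p.[1] = \sum_(i < size p) p`_i.
  by rewrite {1}pE horner_sum; apply: eq_bigr => i _; rewrite !hornerS expr1n mulr1.
have p2 : (deriv p).[1] = \sum_(i < size p) p`_i * i%:R.
  by rewrite dE horner_sum; apply: eq_bigr => i _; rewrite !hornerS expr1n mulr1.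
have p3 : (deriv (deriv p)).[1] = \sum_(i < size p) p`_i * (i%:R * (i%:R - 1)).
  rewrite dE raddf_sum horner_sum; apply: eq_bigr => -[[|i] ? _] /=.
    by rewrite scale0r scaler0 derivC horner0 mul0r mulr0.
rewrite !derivZ derivXn !hornerS expr1n.
  by rewrite -natr1 addrK.
rewrite p1 p2 p3 !mulr_sumr -sumrN -!big_split /=.
by apply: eq_bigr => i _; ring.
Qed.

(** For this [s] the geometric mean is [1 / (b + 1)], so the power [n * b.+1] has mean [n] up to the
    truncation. The variance contributes at most [3 n]. The bias is [n * s ^+ L <= 1], and its
    square is at most [n]. *)
Lemma geo_second_moment (n b L : nat) s : s = b.+2%:R^-1 ->
  n%:R * s ^+ L <= 1 ->
  \sum_(l < size (geo s L ^+ (n * b.+1)))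
    (geo s L ^+ (n * b.+1))`_l * (l%:R - n%:R) ^+ 2 <= 4 * n%:R.
Proof.
move=> sE nsL.
have s01 : 0 < s < 1 by rewrite sE invr_gt0 ltr0n invf_lt1 ?ltr0n// ltr1n.
have g1 := geo_horner1 s L.
rewrite second_moment deriv1_exp// deriv2_exp// horner1_exp//.
have := geo_deriv2 L s01; have := geo_deriv1 L s01.
have -> : s / (1 - s) = b.+1%:R^-1.
  rewrite sE -[b.+2%:R]natr1; field.
  by rewrite !gt_eqF// addrC ?natr1 ?ltr0n// -[_ + _]natrD addn1 natr1 ltr0n.
set d1 := (deriv (geo s L)).[1]; set d2 := (deriv (deriv (geo s L))).[1].
set x : R := b.+1%:R; move=> d1E d2E.
have x1 : 1 <= x by rewrite ler1n.
rewrite natrM -/x; set N : R := n%:R in nsL *; set r := s ^+ L in nsL d1E.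
have N0 : 0 <= N by rewrite ler0n.
have r0 : 0 <= r by rewrite exprn_ge0// ltW; case/andP: s01.
have xd1 : x * d1 = 1 - r by rewrite d1E mulrA divff ?mul1r// gt_eqF//; lra.
have xx : x * x^-1 = 1 by rewrite divff// gt_eqF//; lra.
have y1 : x^-1 <= 1 by rewrite invf_le1//; lra.
have y0 : 0 <= x^-1 by rewrite invr_ge0; lra.
have r1 : r <= 1.
  by rewrite exprn_ile1// ltW//; case/andP: s01.
have -> : N * x * (N * x - 1) * d1 ^+ 2 + N * x * d2 + N * x * d1
   - 2 * N * (N * x * d1) + N ^+ 2 * 1 =
   (N * (x * d1) - N) ^+ 2 - N * x * d1 ^+ 2 + N * (x * d2) + N * (x * d1).
  by ring.
have xd2 : x * d2 <= 2.
  apply: le_trans (_ : x * (2 * x^-1 ^+ 2) <= _).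
    by rewrite ler_wpM2l//; lra.
  have -> : x * (2 * x^-1 ^+ 2) = 2 * x^-1 * (x * x^-1) by ring.
  by rewrite xx mulr1 ler_piMr.
have : N * (x * d2) <= N * 2 by rewrite ler_wpM2l.
have : N * (x * d1) <= N by rewrite xd1 ler_piMr//; lra.
have : 0 <= N * x * d1 ^+ 2 by apply: mulr_ge0 (sqr_ge0 _); apply: mulr_ge0.
have -> : (N * (x * d1) - N) ^+ 2 = (N * r) * (N * r) by rewrite xd1; ring.
have : N * r * (N * r) <= N.
  rewrite mulrC; apply: le_trans (_ : 1 * (N * r) <= _).
    by rewrite ler_wpM2r// mulr_ge0.
  by rewrite mul1r ler_piMr.
lra.
Qed.

(* Chebyshev's inequality for [p], whose convolution with the indicator of
   [0, 4 q) is bounded below around [n]. *)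
Lemma interval_mass_ge (p : {poly R}) (n q j : nat) :
  (forall i, 0 <= p`_i) -> p.[1] = 1 ->
  \sum_(l < size p) p`_l * (l%:R - n%:R) ^+ 2 <= 4 * n%:R ->
  (0 < q)%N -> (8 * n <= q ^ 2)%N -> (n + q <= j < n + 3 * q)%N ->
  2^-1 <= \sum_(l < size p) \sum_(m < 4 * q | (l + m == j)%N) p`_l.
Proof.
move=> pl p1 pV q0 nq jq.
have Q0 : (0 : R) < q%:R ^+ 2 by rewrite exprn_gt0// ltr0n.
have : 1 <= \sum_(l < size p) \sum_(m < 4 * q | (l + m == j)%N) p`_l
     + (\sum_(l < size p) p`_l * (l%:R - n%:R) ^+ 2) / q%:R ^+ 2.
  rewrite -[leLHS]p1 horner_coef mulr_suml -big_split /=; apply: ler_sum => l _.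
  rewrite expr1n mulr1.
  (* Either [l] is counted in the first sum, or, since [n + q <= j < n + 3 * q], it lies at distance
     more than [q] from [n]. *)
  have [/andP[lj jl]|nlj] := boolP (l <= j < l + 4 * q)%N.
    have jlq : (j - l < 4 * q)%N by lia.
    rewrite (bigD1 (Ordinal jlq)) /=; last by apply/eqP; lia.
    rewrite -addrA lerDl addr_ge0 ?sumr_ge0//.
    by rewrite divr_ge0 ?(ltW Q0)// mulr_ge0 ?sqr_ge0.
  apply: le_trans (_ : p`_l * (l%:R - n%:R) ^+ 2 / q%:R ^+ 2 <= _); last first.
    by rewrite lerDr sumr_ge0.
  rewrite -mulrA ler_peMr// ler_pdivlMr// mul1r.
  have [ln|nl] := leqP n l.
    by rewrite -natrB// -!natrX ler_nat leq_exp2r//; lia.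
  rewrite -[l%:R - _]opprB sqrrN -natrB ?(ltnW nl)//.
  by rewrite -!natrX ler_nat leq_exp2r//; lia.
(* The assumption [8 * n <= q ^ 2] turns the Chebyshev bound [4 n / q^2] into 1/2. *)
have : (\sum_(l < size p) p`_l * (l%:R - n%:R) ^+ 2) / q%:R ^+ 2 <= 2^-1.
  rewrite ler_pdivrMr//; apply: le_trans pV _.
  have : (8 * n)%:R <= (q ^ 2)%:R :> R by rewrite ler_nat.
  rewrite natrM natrX; lra.
lra.
Qed.
End GeometricKernel.

(** * Convolution by real kernels on sequences of vectors *)

Section RealPolyAction.
Context (R : realType) (H : normedModType R[i]) (T : {linear H -> H}).
Implicit Types (p : {poly R}) (w : R[i]) (x : H).

(** This is [p] evaluated at [w T]. Real coefficients keep positivity and moments of the kernels in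
    the ordered field [R]. *)
Definition act w p x : H := pact T (dil w (map_poly (real_complex R) p)) x.

Lemma actD w p (q : {poly R}) x : act w (p + q) x = act w p x + act w q x.
Proof. by rewrite /act rmorphD dilD pactD. Qed.

Lemma actB w p (q : {poly R}) x : act w (p - q) x = act w p x - act w q x.
Proof. by rewrite /act rmorphB dilB pactB. Qed.

Lemma actM w p (q : {poly R}) x : act w (p * q) x = act w p (act w q x).
Proof. by rewrite /act rmorphM dilM pactM. Qed.

Lemma actC w (a : R) x : act w a%:P x = a%:C *: x.
Proof. by rewrite /act map_polyC dilC pactC. Qed.

Lemma act1 w x : act w 1 x = x.
Proof. by rewrite actC scale1r. Qed.

Lemma actX w x : act w 'X x = w *: T x.
Proof. by rewrite /act map_polyX dilX pactZ pactX. Qed.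

Lemma actE n w p x : (size p <= n)%N ->
  act w p x = \sum_(i < n) w ^+ i *: ((p`_i)%:C *: iter i T x).
Proof.
move=> pn; rewrite /act (@pact_dil _ _ _ n) ?size_map_poly//.
by apply: eq_bigr => i _; rewrite coef_map.
Qed.

Lemma actXM_norm_le w p (c : R) m x : 0 <= c ->
  (forall y, rnorm (act w p y) <= c * rnorm y) ->
  rnorm (act w (p ^+ m) x) <= c ^+ m * rnorm x.
Proof.
move=> c0 pc; elim: m => [|m IH]; first by rewrite act1 mul1r.
by rewrite !exprS actM (le_trans (pc _))// -mulrA ler_wpM2l.
Qed.

(** The discrete Fourier transform turns the convolution of [p] and [u] into the operators
    [act T w p], each of norm at most [A]. Parseval before and after gives the bound. *)
Lemma conv_norm_le p (A : R) J M (u : nat -> H) (dot : {dot H for Num.conj}) :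
  (forall x : H, `|x| ^+ 2 = dot x x) -> 0 <= A -> (J + size p <= M)%N ->
  (forall w x, rnorm w = 1 -> rnorm (act w p x) <= A * rnorm x) ->
  \sum_(j < M) rnorm (\sum_(l < size p) \sum_(m < J | (l + m == j)%N)
     (p`_l)%:C *: iter l T (u m)) ^+ 2 <= A ^+ 2 * \sum_(m < J) rnorm (u m) ^+ 2.
Proof.
move=> dotE A0 JpM pA; have JM : (J <= M)%N by rewrite (leq_trans _ JpM) ?leq_addr.
have [M0|M0] := posnP M.
  by rewrite M0 big_ord0 mulr_ge0 ?sqr_ge0// sumr_ge0// => *; rewrite sqr_ge0.
have [z zM] := prim_root_exists R[i] M0.
have z1 t : rnorm (z ^+ t) = 1 by rewrite rnormX (rnorm_prim_root zM) expr1n.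
pose v j := \sum_(l < size p) \sum_(m < J | (l + m == j)%N)
  (p`_l)%:C *: iter l T (u m).
(* Padding by zeros gives both sequences length [M], so that Parseval applies with the same roots of
   unity. *)
pose u' m := if (m < J)%N then u m else 0.
have uE (F : nat -> H -> R) : (forall m, F m 0 = 0) ->
    \sum_(m < M) F m (u' m) = \sum_(m < J) F m (u m).
  move=> F0; rewrite (big_ord_widen M (fun m => F m (u m))) //.
  rewrite [RHS]big_mkcond; apply: eq_bigr => m _.
  by rewrite /u'; case: ifP.
have uE' w : \sum_(m < M) w ^+ m *: u' m = \sum_(m < J) w ^+ m *: u m.
  rewrite (big_ord_widen M (fun m => w ^+ m *: u m)) //.
  rewrite [RHS]big_mkcond; apply: eq_bigr => m _.
  by rewrite /u'; case: ifP => // _; rewrite scaler0.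
have vE w : \sum_(j < M) w ^+ j *: v j = act w p (\sum_(m < M) w ^+ m *: u' m).
  rewrite uE' (@actE (size p))//.
  transitivity (\sum_(l < size p) \sum_(m < J)
      w ^+ (l + m) *: ((p`_l)%:C *: iter l T (u m))).
    under eq_bigr do rewrite scaler_sumr.
    rewrite exchange_big; apply: eq_bigr => l _ /=.
    under eq_bigr do rewrite scaler_sumr big_mkcond.
    rewrite exchange_big; apply: eq_bigr => m _ /=.
    (* No wrap-around: modulo [M] the cyclic convolution is the ordinary one. *)
    have lm : (l + m < M)%N.
      by rewrite (leq_trans _ JpM)// addnC -addSn leq_add// ltnW.
    rewrite (bigD1 (Ordinal lm))//= eqxx big1 ?addr0// => i il.
    case: eqP => // lmi; case/eqP: il; exact/val_inj.
  apply: eq_bigr => l _; rewrite iter_suml !scaler_sumr; apply: eq_bigr => m _.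
  by rewrite iterZl exprD -scalerA; congr (_ *: _); rewrite !scalerA mulrC.
have MR0 : (0 : R) < M%:R by rewrite ltr0n.
rewrite -(ler_pM2l MR0) -(parseval dotE v zM) mulrCA.
rewrite -(uE (fun _ y => rnorm y ^+ 2)); last first.
  by move=> _; rewrite rnorm0 expr0n.
rewrite -(parseval dotE u' zM) mulr_sumr; apply: ler_sum => t _.
rewrite vE -exprMn ler_pXn2r ?nnegrE ?rnorm_ge0// ?mulr_ge0 ?rnorm_ge0//.
exact: pA.
Qed.
End RealPolyAction.

(** * Kernels whose operators are bounded uniformly on the circle *)

Section BoundedKernel.
Context (R : realType) (H : normedModType R[i]) (T : {linear H -> H}).
Variables (K C : R).
Hypothesis K0 : 0 < K.
Hypothesis TK : forall x, rnorm (T x) <= K * rnorm x.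
Hypothesis C1 : 1 <= C.
Hypothesis Kreiss : forall s m (w : R[i]) x, 0 < s < 1 -> rnorm w = 1 ->
  (1 - s) ^+ m * rnorm x <= C * rnorm (act T w ((1 - s%:P * 'X) ^+ m) x).

(** The bound [1 + 2 i e] on [(1 + e) ^+ i] propagates as long as [2 i e <= 1]. *)
Lemma bernoulli_le2 (e : R) m : 0 <= e -> 2 * m%:R * e <= 1 ->
  (1 + e) ^+ m <= 2.
Proof.
move=> e0 me.
suff /(_ m (leqnn _)) : forall i, (i <= m)%N -> (1 + e) ^+ i <= 1 + 2 * i%:R * e.
  by move=> h; apply: le_trans h _; lra.
elim=> [|i IH] im; first by rewrite mulr0 mul0r addr0.
have {}IH := IH (ltnW im).
have ime : 2 * i%:R * e <= 1.
  by apply: le_trans me; rewrite ler_wpM2r// ler_wpM2l// ler_nat ltnW.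
rewrite exprS; apply: le_trans (_ : (1 + e) * (1 + 2 * i%:R * e) <= _).
  by rewrite ler_wpM2l// addr_ge0.
have : (2 * i%:R * e) * e <= 1 * e by rewrite ler_wpM2r.
by rewrite -natr1; lra.
Qed.

(** The kernel is a power of [geo s L]. Multiplied by [(1 - s%:P * 'X) ^+ m] it becomes [h ^+ m], of
    norm at most [2 * (1 - s) ^+ m] at [w T]. The lower bound [Kreiss] then cancels [(1 - s) ^+ m],
    leaving a constant independent of [n]. *)
Lemma kernel_exists n : exists p : {poly R}, [/\ (forall i, 0 <= p`_i), p.[1] = 1,
  \sum_(l < size p) p`_l * (l%:R - n%:R) ^+ 2 <= 4 * n%:R &
  forall w x, rnorm w = 1 -> rnorm (act T w p x) <= 2 * C * rnorm x].
Proof.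
(* This makes [s = 1 / (b + 2)] small enough for [s T] to have norm at most 1/2. *)
have [b bK] : exists b : nat, 2 * K <= b.+2%:R.
  have := archi_boundP (ltW (mulr_gt0 (ltr0n R 2) K0)).
  set b := Num.bound _ => bK; exists b; rewrite (le_trans (ltW bK))//.
  by rewrite ler_nat; lia.
pose s : R := b.+2%:R^-1; pose m := (n * b.+1)%N.
have s0 : 0 < s by rewrite invr_gt0 ltr0n.
have s2 : s <= 2^-1 by rewrite lef_pV2 ?posrE ?ltr0n// ler_nat.
have s12 : s <= 1 - s by lra.
have C0 : 0 <= C := le_trans ler01 C1.
have sK : s * K <= 2^-1.
  by rewrite /s mulrC ler_pdivrMr ?ltr0n//; lra.
(* The first bound controls the bias of the mean, the second the accumulated error
   [(1 + e) ^+ m]. *)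
have [L nL mL] : exists2 L : nat, n%:R <= (2 : R) ^+ L &
    2 * m%:R * (1 + K) <= 2 ^+ L.
  have c0 : 0 <= 2 * m%:R * (1 + K) by rewrite mulr_ge0 ?mulr_ge0 ?ler0n// addr_ge0 ?ltW.
  have := archi_boundP c0; set L := Num.bound _ => LK.
  exists (n + L)%N; first by rewrite -natrX ler_nat (leq_trans (leq_addr L n))// ltnW// ltn_expl.
  rewrite (le_trans (ltW LK))// -natrX ler_nat (leq_trans (leq_addl n L))// ltnW//.
  by rewrite ltn_expl.
have sL : s ^+ L <= 2^-1 ^+ L by rewrite lerXn2r ?nnegrE ?invr_ge0// ltW.
have p2 : (0 : R) < 2 ^+ L by rewrite exprn_gt0.
have nsL : n%:R * s ^+ L <= 1.
  apply: le_trans (_ : n%:R * 2^-1 ^+ L <= _); first by rewrite ler_wpM2l.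
  by rewrite exprVn ler_pdivrMr// mul1r.
have s01 : 0 < s < 1 by rewrite s0; lra.
exists (geo s L ^+ m); split.
- by apply: coefXn_ge0; apply: coef_geo_ge0; rewrite !ltW//; case/andP: s01.
- by rewrite horner1_exp// geo_horner1.
- exact: geo_second_moment.
move=> w x w1.
(* A bound for the truncation error relative to [1 - s]: it uses [s <= 1 - s] and the norm [1 + K]
   of [1 - w T]. *)
pose e := 2^-1 ^+ L * (1 + K).
have K1 : 0 <= 1 + K by rewrite addr_ge0 ?(ltW K0).
have e0 : 0 <= e by rewrite mulr_ge0 ?exprn_ge0 ?invr_ge0.
pose h := (1 - s)%:P + (s%:P * 'X) ^+ L * (s%:P * (1 - 'X)).
have sT y : rnorm (act T w (s%:P * 'X) y) <= 2^-1 * rnorm y.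
  rewrite actM actC actX !rnormZ w1 mul1r rnorm_real ger0_norm ?(ltW s0)//.
  apply: le_trans (_ : s * (K * rnorm y) <= _); first by rewrite ler_wpM2l// ltW.
  by rewrite mulrA ler_wpM2r// rnorm_ge0.
have hB y : rnorm (act T w h y) <= (1 - s) * (1 + e) * rnorm y.
  rewrite /h actD actC actM; apply: le_trans (ler_rnormD _ _) _.
  rewrite rnormZ rnorm_real ger0_norm; last by lra.
  have -> : (1 - s) * (1 + e) * rnorm y =
    (1 - s) * rnorm y + (1 - s) * e * rnorm y by ring.
  rewrite lerD2l.
  apply: le_trans (actXM_norm_le _ _ _ sT) _; first by rewrite invr_ge0.
  rewrite actM actC actB act1 actX rnormZ rnorm_real ger0_norm ?(ltW s0)//.
  rewrite /e -mulrA [(1 - s) * _]mulrCA -!mulrA ler_wpM2l ?exprn_ge0 ?invr_ge0//.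
  apply: le_trans (_ : s * ((1 + K) * rnorm y) <= _).
    rewrite ler_wpM2l ?(ltW s0)// mulrDl mul1r (le_trans (ler_rnormD _ _))//.
    by rewrite lerD2l rnormN rnormZ w1 mul1r.
  rewrite mulrCA ler_wpM2r ?mulr_ge0 ?rnorm_ge0//.
have es0 : 0 <= (1 - s) * (1 + e) by rewrite mulr_ge0//; lra.
have e2 : (1 + e) ^+ m <= 2.
  apply: bernoulli_le2 => //.
  by rewrite /e mulrCA exprVn mulrC ler_pdivrMr// mul1r.
have := Kreiss m (act T w (geo s L ^+ m) x) s01 w1.
rewrite -actM -exprMn geo_factor -/h => Kx.
have s1m : 0 < (1 - s) ^+ m by rewrite exprn_gt0//; lra.
rewrite -(ler_pM2l s1m) (le_trans Kx)//.
have := actXM_norm_le m x es0 hB; rewrite exprMn => hm.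
apply: le_trans (_ : C * ((1 - s) ^+ m * (1 + e) ^+ m * rnorm x) <= _).
  by rewrite ler_wpM2l.
have -> : (1 - s) ^+ m * (2 * C * rnorm x) =
          C * ((1 - s) ^+ m * 2 * rnorm x) by ring.
rewrite ler_wpM2l//.
by rewrite ler_wpM2r ?rnorm_ge0// ler_wpM2l// ltW.
Qed.
End BoundedKernel.

(** * Inequalities for sums of squares *)

Section SumTools.
Context (R : realType).

Lemma sum_nat_subrange (F : nat -> R) a b M : (forall j, 0 <= F j) ->
  (a <= b <= M)%N -> \sum_(a <= j < b) F j <= \sum_(j < M) F j.
Proof.
move=> F0 /andP[ab bM]; rewrite -(big_mkord xpredT F).
rewrite (big_cat_nat (leq0n a) (leq_trans ab bM))/=.
rewrite [X in _ + X](big_cat_nat ab bM)/= addrCA lerDl.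
by rewrite addr_ge0// sumr_ge0.
Qed.

Lemma sqr_sum_le n (a : nat -> R) :
  (\sum_(j < n) a j) ^+ 2 <= n%:R * \sum_(j < n) a j ^+ 2.
Proof.
elim: n => [|n IH]; first by rewrite !big_ord0 mul0r expr0n.
rewrite !big_ord_recr /= -natr1.
set S := \sum_(_ < n) _ in IH *; set Q := \sum_(_ < n) _ in IH *; set b := a n.
have -> : (n%:R + 1) * (Q + b ^+ 2) = (n%:R * Q) + (n%:R * b ^+ 2 + Q) + b ^+ 2 by ring.
have -> : (S + b) ^+ 2 = S ^+ 2 + 2 * S * b + b ^+ 2 by ring.
rewrite lerD2r lerD//.
have -> : n%:R * b ^+ 2 + Q = \sum_(j < n) (b ^+ 2 + a j ^+ 2).
  by rewrite big_split /= sumr_const card_ord mulr_natl.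
rewrite mulrAC mulr_sumr; apply: ler_sum => j _.
by have := sqr_ge0 (b - a j); rewrite sqrrB; lra.
Qed.

(** Weighted Cauchy-Schwarz, whose defect is the square of [be * a - al * b] over [al * be]. It
    makes the constants of row bounds on adjacent intervals add up. *)
Lemma sqrD_le (a b al be E e : R) : 0 < al -> 0 < be ->
  a ^+ 2 <= al * E -> b ^+ 2 <= be * e -> (a + b) ^+ 2 <= (al + be) * (E + e).
Proof.
move=> al0 be0 aE bE.
have h1 : a ^+ 2 / al <= E by rewrite ler_pdivrMr// mulrC.
have h2 : b ^+ 2 / be <= e by rewrite ler_pdivrMr// mulrC.
apply: le_trans (_ : (al + be) * (a ^+ 2 / al + b ^+ 2 / be) <= _); last first.
  by rewrite ler_wpM2l ?lerD// addr_ge0// ltW.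
rewrite -subr_ge0 (_ : _ - _ = (be * a - al * b) ^+ 2 / (al * be)).
  by rewrite divr_ge0 ?sqr_ge0// mulr_ge0// ltW.
by field; rewrite !gt_eqF.
Qed.
End SumTools.

(** * Logarithmic growth of powers *)

Section PowerGrowth.
Context (R : realType) (H : normedModType R[i]) (dot : {dot H for Num.conj}).
Hypothesis dotE : forall x : H, `|x| ^+ 2 = dot x x.
Context (T : {linear H -> H}).
Implicit Types (x : H) (u : nat -> H).

(** The constant bounds the square of the column norm: powers of norm at most [B] would give
    [c = B ^+ 2 * N%:R]. The same normalisation holds for rows. *)
Definition col_le N (c : R) := forall x,
  \sum_(j < N) rnorm (iter j T x) ^+ 2 <= c * rnorm x ^+ 2.

Definition row_le N (c : R) := forall u,
  rnorm (\sum_(j < N) iter j T (u j)) ^+ 2 <= c * \sum_(j < N) rnorm (u j) ^+ 2.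

Lemma col_leW N M c : (N <= M)%N -> col_le M c -> col_le N c.
Proof.
move=> NM h x; apply: le_trans (h x).
rewrite -(big_mkord xpredT (fun j => rnorm (iter j T x) ^+ 2)).
by apply: sum_nat_subrange => // j; rewrite sqr_ge0.
Qed.

Lemma row_leW N M c : (N <= M)%N -> row_le M c -> row_le N c.
Proof.
move=> NM h u; have := h (fun j => if (j < N)%N then u j else 0).
rewrite (big_ord_widen M (fun j => iter j T (u j)))//.
rewrite (big_ord_widen M (fun j => rnorm (u j) ^+ 2))// !(big_mkcond (fun i : 'I_M => (i < N)%N)) /=.
rewrite (eq_bigr (fun j : 'I_M => if (j < N)%N then iter j T (u j) else 0)).
  move=> /le_trans; apply; rewrite le_eqVlt; apply/orP; left; apply/eqP.
  by congr (_ * _); apply: eq_bigr => j _; case: ifP; rewrite ?rnorm0 ?expr0n.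
by move=> j _; case: ifP; rewrite ?iter0l.
Qed.

Variable A : R.
Hypothesis A1 : 1 <= A.
Hypothesis kernelA : forall n, exists p : {poly R},
  [/\ (forall i, 0 <= p`_i), p.[1] = 1,
  \sum_(l < size p) p`_l * (l%:R - n%:R) ^+ 2 <= 4 * n%:R &
  forall w x, rnorm w = 1 -> rnorm (act T w p x) <= A * rnorm x].

Let A0 : 0 <= A. Proof. exact: le_trans ler01 A1. Qed.

(** Convolving [p] with the sequence of [iter m T x], [m < 4 * q], yields [a j] times [iter j T x],
    where [a j >= 1/2] on the window. Dividing by [a j ^+ 2] costs the factor 4. *)
Lemma col_window n q c : (0 < q)%N -> (8 * n <= q ^ 2)%N -> 0 <= c ->
  col_le (4 * q) c -> forall x,
  \sum_(n + q <= j < n + 3 * q) rnorm (iter j T x) ^+ 2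
    <= 4 * A ^+ 2 * c * rnorm x ^+ 2.
Proof.
move=> q0 nq c0 colc x; have [p [pl p1 pV pA]] := kernelA n.
pose a j := \sum_(l < size p) \sum_(m < 4 * q | (l + m == j)%N) p`_l.
pose M := (4 * q + size p + (n + 3 * q))%N.
have := @conv_norm_le _ _ T p A (4 * q) M (fun m => iter m T x) dot dotE A0
  (leq_addr _ _) pA.
pose F j := rnorm (\sum_(l < size p) \sum_(m < 4 * q | (l + m == j)%N)
  (p`_l)%:C *: iter l T (iter m T x)) ^+ 2.
have FE j : F j = (a j * rnorm (iter j T x)) ^+ 2.
  rewrite /F (_ : \sum_(l < _) _ = (a j)%:C *: iter j T x).
    rewrite rnormZ rnorm_real ger0_norm// /a sumr_ge0// => l _.
    by rewrite sumr_ge0.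
  rewrite rmorph_sum scaler_suml; apply: eq_bigr => l _.
  rewrite rmorph_sum scaler_suml; apply: eq_bigr => m /eqP lm.
  by rewrite -iterD lm.
move=> h; have {h} : \sum_(n + q <= j < n + 3 * q) F j
    <= A ^+ 2 * (c * rnorm x ^+ 2).
  apply: le_trans (_ : \sum_(j < M) F j <= _).
    by apply: sum_nat_subrange => [j|]; [rewrite sqr_ge0|rewrite /M; lia].
  by apply: le_trans h _; rewrite ler_wpM2l ?exprn_ge0.
move=> h; apply: le_trans (_ : 4 * (A ^+ 2 * (c * rnorm x ^+ 2)) <= _); last first.
  by rewrite !mulrA.
apply: le_trans (_ : 4 * \sum_(n + q <= j < n + 3 * q) F j <= _); last first.
  by rewrite ler_wpM2l.
rewrite mulr_sumr !big_seq; apply: ler_sum => j; rewrite mem_index_iota => jq.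
have aj := interval_mass_ge pl p1 pV q0 nq jq; rewrite -/(a j) in aj.
rewrite FE exprMn mulrA ler_peMl ?sqr_ge0//.
have : 2^-1 ^+ 2 <= a j ^+ 2 by rewrite lerXn2r ?nnegrE// (le_trans _ aj).
by rewrite exprVn; lra.
Qed.

(** The index reversal [j |-> J - 1 - j] turns this correlation into a convolution, of which only
    the first [J] entries are kept. *)
Lemma conv_rev_norm_le (p : {poly R}) J (y : nat -> H) :
  (forall w x, rnorm w = 1 -> rnorm (act T w p x) <= A * rnorm x) ->
  \sum_(m < J) rnorm (\sum_(l < size p) \sum_(j < J | (l + m == j)%N)
     (p`_l)%:C *: iter l T (y j)) ^+ 2 <= A ^+ 2 * \sum_(j < J) rnorm (y j) ^+ 2.
Proof.
move=> pA; have revK (j : 'I_J) : (J - (J - j.+1).+1)%N = j.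
  by have := ltn_ord j; lia.
have := @conv_norm_le _ _ T p A J (J + size p) (fun m => y (J - m.+1)%N) dot
  dotE A0 (leqnn _) pA.
have -> : \sum_(m < J) rnorm (y (J - m.+1)%N) ^+ 2 = \sum_(j < J) rnorm (y j) ^+ 2.
  by rewrite (reindex_inj rev_ord_inj); apply: eq_bigr => j _ /=; rewrite revK.
apply: le_trans.
set F := (F in \sum_(j < J + size p) F j).
apply: le_trans (_ : \sum_(j < J) F (lshift _ j) <= _); last first.
  by rewrite big_split_ord lerDl sumr_ge0// => j _; rewrite sqr_ge0.
rewrite [leRHS](reindex_inj rev_ord_inj) /F.
rewrite le_eqVlt; apply/orP; left; apply/eqP; apply: eq_bigr => m _.
congr (rnorm _ ^+ 2); apply: eq_bigr => l _.
rewrite [RHS](reindex_inj rev_ord_inj) /=; apply: eq_big => [j|j _].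
  by apply/eqP/eqP; have := ltn_ord m; have := ltn_ord j; lia.
by rewrite revK.
Qed.

(** Dual to the column case: with [u j = a j * y j], each [a j * T^j (y j)] splits as a sum of
    [T^m (p_l T^l (y j))] over [l + m = j]. Regrouping by [m < 4 * q] gives a short row applied to a
    correlation with [p]. *)
Lemma row_window n q c : (0 < q)%N -> (8 * n <= q ^ 2)%N -> 0 <= c ->
  row_le (4 * q) c -> forall u,
  rnorm (\sum_(n + q <= j < n + 3 * q) iter j T (u j)) ^+ 2
    <= 4 * A ^+ 2 * c * \sum_(n + q <= j < n + 3 * q) rnorm (u j) ^+ 2.
Proof.
move=> q0 nq c0 rowc u; have [p [pl p1 pV pA]] := kernelA n.
pose a j := \sum_(l < size p) \sum_(m < 4 * q | (l + m == j)%N) p`_l.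
pose J := (n + 4 * q)%N.
have a2 j : (n + q <= j < n + 3 * q)%N -> 2^-1 <= a j.
  exact: interval_mass_ge.
pose y j := if (n + q <= j < n + 3 * q)%N then (a j)^-1%:C *: u j else 0.
have rangeE (V : zmodType) (G : nat -> V) :
    \sum_(n + q <= j < n + 3 * q) G j =
    \sum_(j < J) if (n + q <= j < n + 3 * q)%N then G j else 0.
  rewrite (big_nat_widen _ _ J); last by rewrite /J; lia.
  rewrite (big_nat_widenl _ 0)// big_mkord big_mkcond; apply: eq_bigr => j _.
  by rewrite /= andbC.
pose w m := \sum_(l < size p) \sum_(j < J | (l + m == j)%N)
     (p`_l)%:C *: iter l T (y j).
have wE : \sum_(n + q <= j < n + 3 * q) iter j T (u j) =
    \sum_(m < 4 * q) iter m T (w m).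
  rewrite rangeE; transitivity (\sum_(j < J) (a j)%:C *: iter j T (y j)).
    apply: eq_bigr => j _; rewrite /y; case: ifP => jq; last first.
      by rewrite iter0l scaler0.
    rewrite iterZl scalerA -rmorphM mulfV ?scale1r//.
    by rewrite gt_eqF// (lt_le_trans _ (a2 _ jq)).
  rewrite /w; transitivity (\sum_(m < 4 * q) \sum_(l < size p) \sum_(j < J)
      if (l + m == j)%N then (p`_l)%:C *: iter j T (y j) else 0); last first.
    apply: eq_bigr => m _; rewrite iter_suml; apply: eq_bigr => l _.
    rewrite iter_suml -big_mkcond; apply: eq_bigr => j /eqP lm.
    by rewrite iterZl -iterD addnC lm.
  under [RHS]eq_bigr do rewrite exchange_big.
  rewrite exchange_big; apply: eq_bigr => j _ /=.
  rewrite exchange_big rmorph_sum scaler_suml; apply: eq_bigr => l _ /=.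
  by rewrite rmorph_sum scaler_suml -big_mkcond.
rewrite wE; apply: le_trans (rowc w) _.
have -> : 4 * A ^+ 2 * c * \sum_(n + q <= j < n + 3 * q) rnorm (u j) ^+ 2
  = c * (A ^+ 2 * (4 * \sum_(n + q <= j < n + 3 * q) rnorm (u j) ^+ 2)) by ring.
rewrite ler_wpM2l//.
apply: le_trans (_ : \sum_(m < J) rnorm (w m) ^+ 2 <= _).
  rewrite -(big_mkord xpredT (fun m => rnorm (w m) ^+ 2)).
  by apply: sum_nat_subrange => [j|]; [rewrite sqr_ge0|rewrite /J; lia].
apply: le_trans (conv_rev_norm_le _ _ pA) _.
rewrite ler_wpM2l ?exprn_ge0// rangeE mulr_sumr; apply: ler_sum => j _.
rewrite /y; case: ifP => jq; last by rewrite rnorm0 expr0n mulr0.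
rewrite rnormZ exprMn ler_wpM2r ?sqr_ge0// rnorm_real real_normK ?num_real//.
have aj := a2 _ jq; have aj0 : 0 < a j by rewrite (lt_le_trans _ aj).
rewrite exprVn invf_ple ?posrE ?exprn_gt0//.
have : 2^-1 ^+ 2 <= a j ^+ 2 by rewrite lerXn2r ?nnegrE// (le_trans _ aj).
by rewrite exprVn (_ : 2 ^+ 2 = 4)//; ring.
Qed.

(** The windows with [n = 2 * q * v], [v < W], tile the range from [q] to [q + 2 * q * W]. Each
    costs [4 * A ^+ 2 * c], and the initial segment of length [q] costs [c]. *)
Lemma col_row_windows q c W : (0 < q)%N -> 0 < c ->
  (forall v, (v < W)%N -> (8 * (2 * q * v) <= q ^ 2)%N) ->
  col_le (4 * q) c -> row_le (4 * q) c ->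
  col_le (q + 2 * q * W) (c + W%:R * (4 * A ^+ 2 * c)) /\
  row_le (q + 2 * q * W) (c + W%:R * (4 * A ^+ 2 * c)).
Proof.
move=> q0 c0 + colc rowc.
have d0 : 0 < 4 * A ^+ 2 * c.
  by rewrite !mulr_gt0 ?exprn_gt0// (lt_le_trans ltr01 A1).
elim: W => [_|W IH hW].
  rewrite muln0 addn0 mul0r addr0; split.
    by apply: col_leW colc; lia.
  by apply: row_leW rowc; lia.
have [|colW rowW] := IH; first by move=> v vW; apply: hW; rewrite ltnS ltnW.
have nq := hW W (ltnSn _).
have q1 : (q + 2 * q * W = 2 * q * W + q)%N by lia.
have q2 : (q + 2 * q * W.+1 = 2 * q * W + 3 * q)%N by lia.
have q3 : (2 * q * W + q <= 2 * q * W + 3 * q)%N by lia.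
have -> : c + W.+1%:R * (4 * A ^+ 2 * c) =
  c + W%:R * (4 * A ^+ 2 * c) + 4 * A ^+ 2 * c by rewrite -natr1; ring.
rewrite q1 in colW rowW; rewrite q2; split.
  move=> x; rewrite -(big_mkord xpredT (fun j => rnorm (iter j T x) ^+ 2)).
  rewrite (big_cat_nat (leq0n _) q3) /= mulrDl big_mkord lerD ?colW//.
  exact: col_window (ltW c0) colc x.
move=> u; rewrite -(big_mkord xpredT (fun j => iter j T (u j))).
rewrite -(big_mkord xpredT (fun j => rnorm (u j) ^+ 2)).
rewrite !(big_cat_nat (leq0n _) q3) /= !(big_mkord xpredT).
apply: le_trans (sqrD_le _ d0 (rowW u) (row_window q0 nq (ltW c0) rowc u)).
  by rewrite lerXn2r ?nnegrE ?addr_ge0 ?rnorm_ge0// ler_rnormD.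
by rewrite ltr_pwDl// mulr_ge0// ltW.
Qed.

(** The constant 15 is 5 times 3: the windows and the initial segment cost at most [5 * A ^+ 2 * W]
    times the old constant, and [W * (4 * q) <= 3 * N]. *)
Lemma col_row_step N q B : (0 < q)%N -> (4 * q <= N)%N -> (8 * N <= q ^ 2)%N ->
  0 < B -> col_le (4 * q) (B * (4 * q)%:R) -> row_le (4 * q) (B * (4 * q)%:R) ->
  col_le N (15 * A ^+ 2 * B * N%:R) /\ row_le N (15 * A ^+ 2 * B * N%:R).
Proof.
move=> q0 qN Nq B0 colc rowc; pose W := (N %/ (2 * q)).+1.
have c0 : 0 < B * (4 * q)%:R by rewrite mulr_gt0// ltr0n muln_gt0.
have WN : (2 * q * (N %/ (2 * q)) <= N)%N by rewrite mulnC leq_trunc_div.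
have [|colW rowW] := col_row_windows (W := W) q0 c0 _ colc rowc.
  move=> v; rewrite /W ltnS => vW; rewrite (leq_trans _ Nq)// leq_mul2l /=.
  by rewrite (leq_trans _ WN)// leq_mul2l vW orbT.
have NW : (N <= q + 2 * q * W)%N.
  have := ltn_ceil N (isT : (0 < 2)%N); rewrite (leq_trans _ (leq_addl _ _))//.
  by rewrite mulnC ltnW// ltn_ceil// muln_gt0.
have cE : B * (4 * q)%:R + W%:R * (4 * A ^+ 2 * (B * (4 * q)%:R))
    <= 15 * A ^+ 2 * B * N%:R.
  have A2 : 1 <= A ^+ 2 by rewrite exprn_ege1.
  have W3 : (W * (4 * q) <= 3 * N)%N by rewrite /W; lia.
  have W3' : W%:R * (4 * q)%:R <= 3 * N%:R :> R by rewrite -!natrM ler_nat.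
  have W1 : (1 : R) <= W%:R by rewrite ler1n.
  have q4 : 0 <= (4 * q)%:R :> R by [].
  apply: le_trans (_ : 5 * A ^+ 2 * B * (W%:R * (4 * q)%:R) <= _); last first.
    have -> : 15 * A ^+ 2 * B * N%:R = 5 * A ^+ 2 * B * (3 * N%:R) by ring.
    by rewrite ler_wpM2l// !mulr_ge0// ltW// (lt_le_trans ltr01 A2).
  have : 1 * 1 <= A ^+ 2 * W%:R by apply: ler_pM.
  rewrite mulr1 => AW.
  have : 1 * (B * (4 * q)%:R) <= A ^+ 2 * W%:R * (B * (4 * q)%:R).
    by rewrite ler_wpM2r// ltW.
  by lra.
split=> [x|u].
  apply: le_trans (col_leW NW colW x) _; rewrite ler_wpM2r ?sqr_ge0//.
apply: le_trans (row_leW NW rowW u) _; rewrite ler_wpM2r ?sumr_ge0// => j _.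
by rewrite sqr_ge0.
Qed.

Variable K : R.
Hypothesis K1 : 1 <= K.
Hypothesis TK : forall x, rnorm (T x) <= K * rnorm x.

Lemma iter_rnorm_le M j x : (j <= M)%N -> rnorm (iter j T x) <= K ^+ M * rnorm x.
Proof.
move=> jM; apply: le_trans (_ : K ^+ j * rnorm x <= _); last first.
  by rewrite ler_wpM2r ?rnorm_ge0// ler_weXn2l.
elim: j {jM} => [|j IH]; first by rewrite mul1r.
rewrite iterS exprS -mulrA (le_trans (TK _))// ler_wpM2l//.
exact: le_trans ler01 K1.
Qed.

Lemma col_row_base N M : (N <= M)%N ->
  col_le N ((K ^+ M) ^+ 2 * N%:R) /\ row_le N ((K ^+ M) ^+ 2 * N%:R).
Proof.
move=> NM; have KM0 : 0 <= K ^+ M by rewrite exprn_ge0// (le_trans ler01 K1).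
have TM (j : 'I_N) x : rnorm (iter j T x) ^+ 2 <= (K ^+ M) ^+ 2 * rnorm x ^+ 2.
  rewrite -exprMn lerXn2r ?nnegrE ?mulr_ge0 ?rnorm_ge0//.
  by rewrite iter_rnorm_le// (leq_trans _ NM)// ltnW.
split=> [x|u].
  apply: le_trans (_ : \sum_(j < N) (K ^+ M) ^+ 2 * rnorm x ^+ 2 <= _).
    exact: ler_sum.
  by rewrite sumr_const card_ord -[leLHS]mulr_natl [leRHS]mulrAC [leRHS]mulrC.
apply: le_trans (_ : (\sum_(j < N) rnorm (iter j T (u j))) ^+ 2 <= _).
  rewrite lerXn2r ?nnegrE ?rnorm_ge0 ?sumr_ge0 ?ler_rnorm_sum// => *.
  exact: rnorm_ge0.
apply: le_trans (sqr_sum_le _ (fun j => rnorm (iter j T (u j)))) _.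
rewrite [_ * N%:R]mulrC -mulrA ler_wpM2l// mulr_sumr.
by apply: ler_sum => j _; exact: TM.
Qed.

(* With [x = 2 ^ 2 ^ i] and [q = 32 * x], windows of length [4 * q = 128 * x]
   control ranges up to [q ^ 2 / 8 = 128 * x ^ 2], so each step squares [x] at
   the cost of a constant factor. *)
Lemma col_row_tower M i N : (512 <= M)%N ->
  (128 * 2 ^ (2 ^ i) <= N)%N -> (N <= 128 * (2 ^ (2 ^ i)) ^ 2)%N ->
  let c := (K ^+ M) ^+ 2 * (15 * A ^+ 2) ^+ i * N%:R in
  col_le N c /\ row_le N c.
Proof.
move=> M512; elim: i N => [|i IH] N xN Nx /=.
  by rewrite (expr0 (15 * A ^+ 2)) mulr1; apply: col_row_base; rewrite (leq_trans Nx) ?(leq_trans _ M512).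
have xS : (2 ^ (2 ^ i.+1) = (2 ^ (2 ^ i)) ^ 2)%N by rewrite expnS mulnC expnM.
have x0 : (0 < 2 ^ (2 ^ i))%N by rewrite expn_gt0.
rewrite xS in xN Nx; set x := (2 ^ (2 ^ i))%N in IH xN Nx x0.
pose q := (32 * x ^ 2)%N.
have q4 : (4 * q = 128 * x ^ 2)%N by rewrite /q mulnA.
have q0 : (0 < q)%N by rewrite muln_gt0 expn_gt0 x0.
have [||colq rowq] := IH (4 * q)%N.
- by rewrite q4 leq_mul2l /= -mulnn leq_pmulr.
- by rewrite q4.
rewrite (exprS (15 * A ^+ 2)).
have -> : (K ^+ M) ^+ 2 * (15 * A ^+ 2 * (15 * A ^+ 2) ^+ i) * N%:R =
  15 * A ^+ 2 * ((K ^+ M) ^+ 2 * (15 * A ^+ 2) ^+ i) * N%:R.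
  by rewrite mulrCA.
apply: (@col_row_step N q) => //.
- by rewrite q4.
- rewrite /q expnMn (_ : (32 ^ 2 = 8 * 128)%N)// -mulnA leq_mul2l /=.
  by rewrite (leq_trans Nx)// -!expnM.
have A0' : 0 < A := lt_le_trans ltr01 A1.
have K0 : 0 < K := lt_le_trans ltr01 K1.
by rewrite !(mulr_gt0, exprn_gt0).
Qed.

(** Write [(n + 1) T^n x] as the sum of [T^j (T^(n-j) x)]: a row applied to a reversed column. The
    two square roots multiply to [c * n.+1%:R]. *)
Lemma col_row_power n c x : 0 <= c ->
  col_le n.+1 (c * n.+1%:R) -> row_le n.+1 (c * n.+1%:R) ->
  rnorm (iter n T x) <= c * rnorm x.
Proof.
move=> c0 colc rowc; set N := n.+1 in colc rowc.
have N0 : (0 : R) < N%:R by rewrite ltr0n.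
have cN0 : 0 <= c * N%:R by rewrite mulr_ge0// ltW.
have := rowc (fun j => iter (n - j) T x).
rewrite (_ : \sum_(j < N) _ = N%:R *: iter n T x); last first.
  rewrite -[in RHS](card_ord N) -sum1_card natr_sum scaler_suml.
  apply: eq_bigr => j _; rewrite scale1r -iterD subnKC//.
  by rewrite -ltnS.
rewrite rnormZ rnorm_nat => h.
have : (N%:R * rnorm (iter n T x)) ^+ 2 <= (c * N%:R * rnorm x) ^+ 2.
  apply: le_trans h _.
  have -> : (c * N%:R * rnorm x) ^+ 2 = c * N%:R * (c * N%:R * rnorm x ^+ 2) by ring.
  rewrite ler_wpM2l//.
  apply: le_trans (colc x); rewrite (reindex_inj rev_ord_inj) /=.
  rewrite le_eqVlt; apply/orP; left; apply/eqP; apply: eq_bigr => j _.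
  by rewrite subSS subKn// -ltnS.
rewrite ler_pXn2r ?nnegrE ?mulr_ge0 ?rnorm_ge0//.
by rewrite mulrAC mulrC ler_pM2r.
Qed.

(** The shift by 4 exceeds [e], so powers of this logarithm absorb constants for every [n],
    including 0. *)
Lemma ln4_ge1 n : 1 <= ln (n.+4%:R : R).
Proof.
rewrite -[leLHS](@expRK R) ler_ln ?posrE ?expR_gt0 ?ltr0n//.
have h : expR (2^-1 : R) <= 2.
  have := expR_ge1Dx (- 2^-1 : R); rewrite expRN => h.
  rewrite -lef_pV2 ?posrE ?expR_gt0//.
  by apply: le_trans h; lra.
rewrite (_ : expR 1 = expR (2^-1 + 2^-1 : R)); last by congr expR; lra.
rewrite expRD; apply: le_trans (_ : 2 * 2 <= _).
  by apply: ler_pM => //; exact: expR_ge0.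
have -> : (2 * 2 : R) = 4%:R by rewrite -natrM.
by rewrite ler_nat.
Qed.

(** The tower reaches [n] after [i] steps, with [2 ^+ i] at most of order [ln n]. The accumulated
    constant [E ^+ i] is therefore at most a power of the logarithm. *)
Lemma power_growth : exists2 D : R, 0 < D & exists2 kappa, (0 < kappa)%N &
  forall n x, rnorm (iter n T x) <= D * ln n.+4%:R ^+ kappa * rnorm x.
Proof.
(* [512 = 128 * 2 ^ 2] is the longest range at level 0 of the tower; the value is kept abstract. *)
have [M M512] : exists M, (512 <= M)%N by exists 512%N.
pose E := 15 * A ^+ 2; pose B := (K ^+ M) ^+ 2.
have K0 : 0 < K := lt_le_trans ltr01 K1.
have B0 : 0 < B by rewrite !exprn_gt0.
have E0 : 0 <= E by rewrite mulr_ge0 ?exprn_ge0.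
(* This choice gives [E ^+ i <= (2 ^+ i) ^+ kappa]. *)
have [kappa k0 kE] : exists2 kappa : nat, (0 < kappa)%N & E <= 2 ^+ kappa.
  have := archi_boundP E0; set k := Num.bound _ => Ek.
  exists k.+1 => //; rewrite (le_trans (ltW Ek))// -natrX ler_nat.
  by rewrite ltnW// (ltn_trans (ltnSn _))// ltn_expl.
have ln2 : (0 : R) < ln 2 by rewrite ln_gt0// ltr1n.
pose D := K ^+ M + B / ln 2 ^+ kappa.
have D2 : 0 < B / ln 2 ^+ kappa by rewrite divr_gt0 ?exprn_gt0.
have D1 : 0 < K ^+ M by rewrite exprn_gt0.
exists D; first by rewrite addr_gt0.
exists kappa => // n x; have lnn := ln4_ge1 n.
have lnk : 1 <= ln (n.+4%:R : R) ^+ kappa by rewrite exprn_ege1.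
have [nsmall|nbig] := leqP n M.
  apply: le_trans (iter_rnorm_le x nsmall) _; rewrite ler_wpM2r ?rnorm_ge0//.
  rewrite -[leLHS]mulr1 ler_pM//; first exact: ltW.
  by rewrite lerDl ltW.
have ex : exists i, (128 * 2 ^ (2 ^ i) <= n)%N 
  by exists 0%N; rewrite (leq_trans _ (ltnW nbig))// (leq_trans _ M512).
have bnd i : (128 * 2 ^ (2 ^ i) <= n)%N -> (i <= n)%N.
  apply: leq_trans; apply: leq_trans (leq_pmull _ _) => //.
  by rewrite ltnW// (leq_trans (ltn_expl i (ltnSn 1)))// ltnW// ltn_expl.
(* The maximal level: since level [i.+1] starts beyond [n], level [i] covers the length [n.+1]. *)
case: (ex_maxnP ex bnd) => i xn imax.
have nx : (n.+1 <= 128 * (2 ^ (2 ^ i)) ^ 2)%N.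
  have xS : (2 ^ (2 ^ i.+1) = (2 ^ (2 ^ i)) ^ 2)%N by rewrite expnS mulnC expnM.
  rewrite -xS leqNgt ltnS; apply/negP => h.
  by have := imax _ h; rewrite ltnn.
have [] := @col_row_tower M i n.+1 M512 (leqW xn) nx; rewrite -/B -/E => coln rown.
have Ei0 : 0 <= B * E ^+ i by rewrite mulr_ge0 ?exprn_ge0// ltW.
apply: le_trans (col_row_power x Ei0 coln rown) _.
rewrite ler_wpM2r ?rnorm_ge0//.
have iln : 2 ^+ i * ln 2 <= ln (n.+4%:R : R).
  rewrite -natrX mulr_natl -lnXn//; rewrite ler_ln ?posrE ?exprn_gt0 ?ltr0n//.
  rewrite -natrX ler_nat (leq_trans (leq_pmull _ (ltn0Sn 127)))//.
  by rewrite (leq_trans xn)// -addn4 leq_addr.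
apply: le_trans (_ : B * ((2 ^+ i) ^+ kappa) <= _).
  by rewrite ler_wpM2l ?(ltW B0)// exprAC lerXn2r ?nnegrE ?exprn_ge0.
apply: le_trans (_ : B / ln 2 ^+ kappa * ln n.+4%:R ^+ kappa <= _); last first.
  by rewrite ler_wpM2r ?lerDr ?(ltW D1)// (le_trans ler01 lnk).
rewrite -mulrA ler_wpM2l ?(ltW B0)// mulrC ler_pdivlMr ?exprn_gt0//.
by rewrite -exprMn lerXn2r ?nnegrE ?mulr_ge0 ?exprn_ge0// ?(ltW ln2)// (le_trans ler01).
Qed.

End PowerGrowth.

(** * Resolvent conditions as lower bounds *)

Section APriori.
Context (R : realType) (H : normedModType R[i]) (T : {linear H -> H}).

(** Turns upper bounds on resolvent powers into lower bounds on powers of [l - T], which involve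
    only polynomials in [T]. *)
Lemma resolvent_apriori l n x : resolvent_set T l ->
  rnorm x <= opnorm (iter n (resolvent l T)) *
             rnorm (iter n (fun y => l *: y - T y) x).
Proof.
move=> [S [/linear_rnorm_bound[K K0 SK] Sl lS]].
(* The chosen preimage is the only one, because [S] is a left inverse of [l - T]. *)
have SE y : resolvent l T y = S y.
  rewrite /resolvent; case: xgetP => [z _ /= <-|/(_ (S y))/=]; first by rewrite Sl.
  by rewrite lS.
have SnE y : iter n (resolvent l T) y = iter n S y by exact: eq_iter.
have Snl : iter n S (iter n (fun y => l *: y - T y) x) = x.
  by elim: n {SnE} => // n IH; rewrite iterSr iterS Sl.
rewrite -{1}Snl -SnE; apply: (@opnorm_ge _ _ _ (K ^+ n)) => [a y|y].
  by rewrite !SnE iterZl.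
rewrite SnE; elim: n {SnE Snl} => [|n IH]; first by rewrite mul1r.
by rewrite exprS -mulrA iterS (le_trans (SK _))// ler_wpM2l// ltW.
Qed.

Lemma resolvent_setP l : spectrum T `<=` @closed_unit_disk R -> 1 < rnorm l ->
  resolvent_set T l.
Proof.
move=> sT l1; apply: contrapT => /sT; rewrite /closed_unit_disk /= rnormE lecR.
by rewrite leNgt l1.
Qed.

(** Take [l = 1 / (s w)]: then [l - T = l (1 - s w T)] and [|l| - 1 = (1 - s) / s], so the powers of
    [s] cancel. *)
Lemma Kreiss_apriori : strongly_Kreiss_bounded T ->
  exists2 C : R, 1 <= C & forall s m (w : R[i]) x, 0 < s < 1 -> rnorm w = 1 ->
  (1 - s) ^+ m * rnorm x <= C * rnorm (act T w ((1 - s%:P * 'X) ^+ m) x).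
Proof.
(* A constant at least 1 also covers [m = 0], about which the Kreiss condition says nothing. *)
move=> [sT [C C0 CT]]; exists (C + 1); first by rewrite lerDr ltW.
move=> s m w x /andP[s0 s1] w1.
have C1 : 0 <= C + 1 by rewrite addr_ge0// ltW.
case: m => [|m].
  by rewrite act1 mul1r ler_peMl ?rnorm_ge0// lerDr ltW.
have w0 : w != 0 by apply: contra_eq_neq w1 => ->; rewrite rnorm0 eq_sym oner_eq0.
have sC0 : s%:C != 0 by rewrite (inj_eq (@complexI R)) gt_eqF.
pose l := (s%:C * w)^-1.
have l1 : rnorm l = s^-1.
  apply: (mulIf (lt0r_neq0 s0)); rewrite mulVf ?gt_eqF//.
  have <- : rnorm (s%:C * w) = s by rewrite rnormM rnorm_real w1 mulr1 gtr0_norm.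
  by rewrite -rnormM mulVf ?rnorm1// mulf_neq0.
have s1' : 1 < s^-1 by rewrite invf_gt1.
have lE y : l *: y - T y = l *: act T w (1 - s%:P * 'X) y.
  rewrite actB act1 actM actC actX scalerBr; congr (_ - _).
  by rewrite !scalerA mulVf ?scale1r// mulf_neq0.
have lnE : iter m.+1 (fun y => l *: y - T y) x =
    l ^+ m.+1 *: act T w ((1 - s%:P * 'X) ^+ m.+1) x.
  elim: m.+1 => [|n IH]; first by rewrite scale1r act1.
  by rewrite iterS IH lE !exprS actM -scalerA /act pactZr.
have lr : resolvent_set T l by apply: resolvent_setP; rewrite ?l1.
have := resolvent_apriori m.+1 x lr; rewrite lnE rnormZ rnormX l1 => h.
have lC : 1 < `|l| by rewrite rnormE ltcR l1.
have := CT l m.+1 lC isT; rewrite -/(rnorm l) l1 => {}CT.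
have s1'' : 0 < 1 - s by rewrite subr_gt0.
set Z := rnorm (act _ _ _ _) in h *.
have {h} : rnorm x <= C / (s^-1 - 1) ^+ m.+1 * (s^-1 ^+ m.+1 * Z).
  by apply: le_trans h _; rewrite ler_wpM2r// mulr_ge0 ?rnorm_ge0// exprn_ge0// invr_ge0 ltW.
have -> : C / (s^-1 - 1) ^+ m.+1 * (s^-1 ^+ m.+1 * Z) = C * Z / (1 - s) ^+ m.+1.
  have -> : s^-1 - 1 = (1 - s) * s^-1 by rewrite mulrBl mulfV ?gt_eqF// mul1r.
  rewrite exprMn; field; rewrite !expf_neq0 ?gt_eqF//.
  by rewrite invr_gt0.
rewrite ler_pdivlMr ?exprn_gt0// mulrC => /le_trans; apply.
by rewrite ler_wpM2r ?rnorm_ge0// lerDl.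
Qed.

Lemma Ritt_apriori alpha : 1 < alpha -> alpha_Ritt alpha T ->
  exists2 C : R, 1 <= C & forall (w : R[i]) x, rnorm w = 1 ->
  rnorm (1 - w) `^ alpha * rnorm x <= C * rnorm (act T w (1 - 'X) x).
Proof.
move=> a1 [sT [C C0 CT]]; pose C' := C * 2 `^ alpha.
have p2 : 0 < (2 : R) `^ alpha by rewrite powR_gt0.
exists (C' + 1); first by rewrite lerDr ltW// mulr_gt0.
have C'0 : 0 < C' by rewrite mulr_gt0.
move=> w x w1; set d := rnorm (1 - w); set X := rnorm x; set Y := rnorm _.
have X0 : 0 <= X := rnorm_ge0 _; have Y0 : 0 <= Y := rnorm_ge0 _.
have [d0|d0] := eqVneq d 0.
  rewrite d0 powR0 ?mul0r ?mulr_ge0// ?addr_ge0 ?(ltW C'0)//.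
  by rewrite gt_eqF// (lt_trans ltr01).
have {}d0 : 0 < d by rewrite lt_def d0 rnorm_ge0.
apply: le_trans (_ : C' * Y <= _); last by rewrite ler_wpM2r// lerDl.
apply/ler_addgt0Pr => e e0.
have w0 : w != 0 by apply: contra_eq_neq w1 => ->; rewrite rnorm0 eq_sym oner_eq0.
have CX0 : 0 < C' * (X + 1) by rewrite mulr_gt0// ltr_wpDl.
(* The three bounds keep [|l - 1| >= d / 2], keep [|l| < 2], and make the error [C' * r * X] at most
   [e]. The summand 1 in [X + 1] avoids a zero denominator. *)
pose r := Num.min (Num.min (d / 2) (2^-1)) (e / (C' * (X + 1))).
have r0 : 0 < r.
  by rewrite !lt_min invr_gt0 (divr_gt0 d0) ?(divr_gt0 e0) ?ltr0n.
have [rd r1 re] : [/\ r <= d / 2, r <= 2^-1 & r <= e / (C' * (X + 1))].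
  by split; rewrite /r ?ge_min ?lexx ?orbT.
pose l := (1 + r)%:C * w^-1.
have wV : rnorm w^-1 = 1.
  by have := rnormM w w^-1; rewrite mulfV// rnorm1 w1 mul1r.
have r1' : 0 < 1 + r by rewrite addr_gt0.
have l1 : rnorm l = 1 + r by rewrite rnormM rnorm_real wV mulr1 gtr0_norm.
have lr : resolvent_set T l by apply: resolvent_setP => //; rewrite l1 ltrDl.
have := resolvent_apriori 1 x lr; rewrite /= -/X => h.
have lx : rnorm (l *: x - T x) <= Y + r * X.
  have -> : l *: x - T x = w^-1 *: act T w (1 - 'X) x + (r%:C * w^-1) *: x.
    rewrite actB act1 actX scalerBr scalerA mulVf// scale1r addrAC -scalerDl.
    by rewrite /l rmorphD /= mulrDl mul1r.
  rewrite (le_trans (ler_rnormD _ _))// !rnormZ wV mul1r rnormM rnorm_real wV.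
  by rewrite mulr1 gtr0_norm.
have ld : d / 2 <= rnorm (l - 1).
  have : d <= rnorm (l - 1) + r.
    have -> : d = rnorm (w^-1 * (1 - w)) by rewrite rnormM wV mul1r.
    have -> : w^-1 * (1 - w) = (l - 1) - r%:C * w^-1.
      by rewrite mulrBr mulr1 mulVf// /l rmorphD mulrDl mul1r addrAC addrK.
    rewrite (le_trans (ler_rnormD _ _))// rnormN rnormM rnorm_real wV mulr1.
    by rewrite gtr0_norm.
  by lra.
have lC1 : 1 < `|l| by rewrite rnormE ltcR l1 ltrDl.
have lC2 : `|l| < 2.
  rewrite rnormE -(rmorph_nat (real_complex R) 2) ltcR l1; lra.
have := CT l lC1 lC2; rewrite -/(rnorm (l - 1)) => {}CT.
have d2 : 0 < d / 2 by rewrite divr_gt0.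
have pd : 0 < (d / 2) `^ alpha by rewrite powR_gt0.
have a0 : 0 <= alpha by rewrite ltW// (lt_trans ltr01).
have {h} : X <= C / (d / 2) `^ alpha * (Y + r * X).
  apply: le_trans h _; apply: le_trans (ler_wpM2r (rnorm_ge0 _) CT) _.
  apply: ler_pM => //; first by rewrite divr_ge0 ?powR_ge0// ltW.
    exact: rnorm_ge0.
  rewrite ler_wpM2l ?(ltW C0)// lef_pV2 ?posrE//; last first.
    by rewrite powR_gt0// (lt_le_trans d2).
  by rewrite ge0_ler_powR ?nnegrE ?rnorm_ge0 ?(ltW d2).
have -> : C / (d / 2) `^ alpha = C' / d `^ alpha.
  have -> : d `^ alpha = (d / 2) `^ alpha * 2 `^ alpha.
    by rewrite -powRM ?divfK// ltW.
  by rewrite /C'; field; rewrite !gt_eqF.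
rewrite -mulrA mulrC -mulrA ler_pdivlMl ?powR_gt0// => /le_trans; apply.
rewrite mulrC mulrDr lerD2l.
apply: le_trans (_ : e / (C' * (X + 1)) * (C' * (X + 1)) <= _); last first.
  by rewrite divfK ?gt_eqF.
rewrite mulrCA; apply: ler_pM => //; rewrite ?(ltW r0) ?(mulr_ge0 (ltW C'0) X0)//.
by rewrite ler_wpM2l ?(ltW C'0)// lerDl.
Qed.
End APriori.

(** * Decay *)

Section WindowPoly.
Context (R : realType).
Implicit Types (p : {poly R}) (c : R).

Definition geosum N : {poly R} := \sum_(i < N) 'X^i.

Lemma geosum_factor N : (1 - 'X) * geosum N = 1 - 'X^N.
Proof. by rewrite -opprB mulNr -subrX1 opprB. Qed.

Definition coef_bounded c p := forall j, `|p`_j| <= c.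

Lemma coef_bounded_geosum N : coef_bounded 1 (geosum N).
Proof.
move=> j; rewrite /geosum coef_sum; under eq_bigr do rewrite coefXn.
have [jN|Nj] := ltnP j N.
  rewrite (bigD1 (Ordinal jN))//= eqxx big1 ?addr0 ?normr1// => i ij.
  by case: eqP => // ji; case/eqP: ij; apply: val_inj.
rewrite big1 ?normr0// => i _; case: eqP => // ji.
by have := ltn_ord i; rewrite -ji ltnNge Nj.
Qed.

Lemma coef_boundedXn c p n : coef_bounded c p -> coef_bounded c ('X^n * p).
Proof.
move=> pc j; rewrite coefXnM; case: ltnP => _; last exact: pc.
by rewrite normr0 (le_trans _ (pc 0%N)).
Qed.

Lemma coef_bounded_geosumM N c p :
  coef_bounded c p -> coef_bounded (N%:R * c) (geosum N * p).
Proof.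
move=> pc j; rewrite /geosum mulr_suml coef_sum (le_trans (ler_norm_sum _ _ _))//.
apply: le_trans (_ : \sum_(i < N) c <= _).
  by apply: ler_sum => i _; apply: coef_boundedXn.
by rewrite sumr_const card_ord mulr_natl.
Qed.

Lemma coef_bounded_subXnM n c p :
  coef_bounded c p -> coef_bounded (2 * c) ((1 - 'X^n) * p).
Proof.
move=> pc j; rewrite mulrBl mul1r coefB (le_trans (ler_normB _ _))//.
by have := pc j; have := coef_boundedXn n pc j; lra.
Qed.

Lemma size_geosum N : (size (geosum N) <= N)%N.
Proof.
rewrite /geosum (leq_trans (size_sum _ _ _))//; apply/bigmax_leqP => i _.
by rewrite size_polyXn.
Qed.

(** For [i <= k] this is [(1 - 'X) ^+ (k - i) * geosum N ^+ k.+1], where each [1 - 'X] has absorbed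
    one [geosum N]. This form shows that the coefficients are of order [N ^ i]. *)
Definition window N k i : {poly R} := (1 - 'X^N) ^+ (k - i) * geosum N ^+ i.+1.

Lemma coef_bounded_window N k i :
  coef_bounded (2 ^+ (k - i) * N%:R ^+ i) (window N k i).
Proof.
rewrite /window; elim: (k - i)%N => [|j IH]; last first.
  rewrite (exprS 2) (exprS (1 - 'X^N)) -!mulrA.
  exact: coef_bounded_subXnM.
rewrite !mul1r; elim: i => [|i IH]; first exact: coef_bounded_geosum.
by rewrite exprS [geosum N ^+ _]exprS; apply: coef_bounded_geosumM.
Qed.

Lemma size_geosumX N k : (0 < N)%N -> (size (geosum N ^+ k) <= (k * N.-1).+1)%N.
Proof.
move=> N0; elim: k => [|k IH]; first by rewrite size_poly1.
rewrite exprS (leq_trans (size_polyMleq _ _))//.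
by have := size_geosum N; lia.
Qed.

Lemma size_window N k i : (0 < N)%N -> (i <= k)%N ->
  (size (window N k i) <= (k.+1 * N).+1)%N.
Proof.
move=> N0 ik.
have : (size ((1 - 'X^N : {poly R}) ^+ (k - i)) <= ((k - i) * N).+1)%N.
  elim: (k - i)%N => [|j IH]; first by rewrite size_poly1.
  rewrite exprS (leq_trans (size_polyMleq _ _))//.
  have : (size (1 - 'X^N : {poly R})%R <= N.+1)%N.
    by rewrite (leq_trans (size_polyD _ _))// size_polyN size_polyXn size_poly1 geq_max !ltnS leq0n leqnn.
  by lia.
have := size_geosumX i.+1 N0.
have : (size (window N k i) <= _)%N := size_polyMleq _ _.
have : (i.+1 * N.-1 <= i.+1 * N)%N by rewrite leq_mul2l leq_pred orbT.
have -> : (k.+1 * N = (k - i) * N + i.+1 * N)%N.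
  by rewrite -mulnDl addnS subnK.
move: ((k - i) * N)%N (i.+1 * N)%N (i.+1 * N.-1)%N => a b c.
move=> cb wE gE aE; apply: leq_trans wE _.
have := leq_add aE (leq_trans gE (cb : (c < b.+1)%N)).
by rewrite addSn addnS; case: (_ + _)%N.
Qed.

(** In the Ritt bound, [i] factors [1 - 'X] lead from window [i] to window 0, whose coefficients are
    bounded independently of [N]. *)
Lemma window_factor N k i : (i <= k)%N ->
  (1 - 'X) ^+ i * window N k i = window N k 0.
Proof.
move=> ik; rewrite /window subn0 -{2}(subnKC ik) exprD.
have <- : (1 - 'X) ^+ i * geosum N ^+ i = (1 - 'X^N) ^+ i.
  by rewrite -exprMn geosum_factor.
by rewrite exprS expr1; move: (_ ^+ (k - i)) => p; ring.
Qed.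

Lemma geosum_window N k i : (i <= k)%N ->
  (1 - 'X) ^+ (k - i) * geosum N ^+ k.+1 = window N k i.
Proof.
move=> ik; rewrite /window -geosum_factor exprMn -mulrA -exprD.
by rewrite addnS subnK.
Qed.

Lemma sum_coef_geosumX N k n : (0 < N)%N -> (k * N.-1 <= n)%N ->
  \sum_(j < n.+1) (geosum N ^+ k)`_j = N%:R ^+ k.
Proof.
move=> N0 kn; have := horner_coef_wide 1 (leq_trans (size_geosumX k N0) (kn : (_ < n.+1)%N)).
under [X in _ = X -> _]eq_bigr do rewrite expr1n mulr1.
move=> <-; rewrite horner_exp horner_sum; under eq_bigr do rewrite hornerXn expr1n.
by rewrite sumr_const card_ord.
Qed.
End WindowPoly.

(** * Mean-square estimates over the circle *)

Section Decay.
Context (R : realType) (H : normedModType R[i]) (dot : {dot H for Num.conj}).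
Hypothesis dotE : forall x : H, `|x| ^+ 2 = dot x x.
Context (T : {linear H -> H}).
Implicit Types (x : H).

Lemma parseval_act M z (p : {poly R}) x : M.-primitive_root z -> (size p <= M)%N ->
  \sum_(t < M) rnorm (act T (z ^+ t) p x) ^+ 2 =
  M%:R * \sum_(j < M) (`|p`_j| * rnorm (iter j T x)) ^+ 2.
Proof.
move=> zM pM; rewrite (eq_bigr (fun t : 'I_M => rnorm (\sum_(j < M)
    (z ^+ t) ^+ j *: ((p`_j)%:C *: iter j T x)) ^+ 2)).
  rewrite (parseval dotE (fun j => (p`_j)%:C *: iter j T x) zM).
  by congr (_ * _); apply: eq_bigr => j _; rewrite rnormZ rnorm_real.
by move=> t _; rewrite (actE _ _ _ pM).
Qed.

Lemma sum_act_norm_le M z (p : {poly R}) c L x : M.-primitive_root z ->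
  (size p <= M)%N -> coef_bounded c p ->
  (forall j, (j < M)%N -> rnorm (iter j T x) <= L * rnorm x) ->
  \sum_(t < M) rnorm (act T (z ^+ t) p x) ^+ 2 <= (M%:R * c * L * rnorm x) ^+ 2.
Proof.
move=> zM pM pc TL; rewrite (parseval_act _ zM pM).
have -> : (M%:R * c * L * rnorm x) ^+ 2 =
   M%:R * (M%:R * (c * (L * rnorm x)) ^+ 2) by ring.
rewrite ler_wpM2l//; apply: le_trans (_ : \sum_(j < M) (c * (L * rnorm x)) ^+ 2 <= _).
  apply: ler_sum => j _; have c0 : 0 <= c := le_trans (normr_ge0 _) (pc 0%N).
  have L0 : 0 <= L * rnorm x := le_trans (rnorm_ge0 _) (TL j (ltn_ord j)).
  rewrite lerXn2r ?nnegrE ?(mulr_ge0 c0 L0) ?mulr_ge0 ?rnorm_ge0//.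
  by apply: ler_pM => //; [exact: rnorm_ge0|exact: TL].
by rewrite sumr_const card_ord mulr_natl.
Qed.

Definition defect x := x - T x.

Lemma iter_defect k x : iter k defect x = pact T ((1 - 'X) ^+ k) x.
Proof.
have E y : defect y = pact T (1 - 'X) y by rewrite pactB pact1 pactX.
by rewrite (eq_iter E) iter_pact.
Qed.

Lemma act_iter_defect w (p : {poly R}) k x :
  act T w p (iter k defect x) = iter k defect (act T w p x).
Proof. by rewrite !iter_defect /act -!pactM mulrC. Qed.

(** Binomial expansion of [w (I - T) = (I - w T) + (w - 1) I]. *)
Lemma iter_defect_expand w k x : w ^+ k *: iter k defect x =
  \sum_(i < k.+1) ('C(k, i)%:R * (w - 1) ^+ i) *: act T w ((1 - 'X) ^+ (k - i)) x.
Proof.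
have -> : w ^+ k *: iter k defect x =
   pact T ((dil w (map_poly (real_complex R) (1 - 'X)) + (w - 1)%:P) ^+ k) x.
  rewrite iter_defect -pactZ -exprZn; congr (pact T (_ ^+ k) x).
  rewrite rmorphB /= rmorph1 map_polyX dilB dil1 dilX -mul_polyC polyCB -mul_polyC.
  by ring.
rewrite exprDn pact_sum; apply: eq_bigr => i _.
rewrite -scaler_nat pactZ -polyC_exp mulrC mul_polyC pactZ scalerA.
by rewrite /act rmorphXn dilXn.
Qed.

Variables (alpha C : R).
Hypothesis alpha1 : 1 < alpha.
Hypothesis C1 : 1 <= C.
Hypothesis Ritt : forall (w : R[i]) x, rnorm w = 1 ->
  rnorm (1 - w) `^ alpha * rnorm x <= C * rnorm (act T w (1 - 'X) x).

Lemma Ritt_iter w i x : rnorm w = 1 ->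
  (rnorm (1 - w) `^ alpha) ^+ i * rnorm x <= C ^+ i * rnorm (act T w ((1 - 'X) ^+ i) x).
Proof.
move=> w1; elim: i x => [|i IH] x; first by rewrite !mul1r act1.
rewrite exprSr -mulrA (le_trans (ler_wpM2l _ (Ritt x w1))) ?exprn_ge0 ?powR_ge0//.
rewrite mulrCA [C ^+ i.+1]exprS -mulrA ler_wpM2l ?(le_trans ler01 C1)//.
by rewrite exprSr actM IH.
Qed.

(** Put [de = N^(-1/alpha)] and [d = |w - 1|]. If [d <= de] the first summand suffices. Otherwise
    [alpha > 1] gives [d <= d^alpha * de^(1 - alpha) = d^alpha * (de * N)], and the iterated Ritt
    bound removes the powers of [d^alpha] in favour of window 0. *)
Lemma near_far_le N k i w x : (0 < N)%N -> (i <= k)%N -> rnorm w = 1 ->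
  rnorm (w - 1) ^+ i * rnorm (act T w (window R N k i) x) <=
  (N%:R `^ (- alpha^-1)) ^+ i * (rnorm (act T w (window R N k i) x) +
     (C * N%:R) ^+ i * rnorm (act T w (window R N k 0) x)).
Proof.
move=> N0 ik w1; set de := _ `^ _; set f := rnorm (act _ _ (window _ _ _ i) _).
set h := rnorm (act _ _ _ _); set d := rnorm _.
have a0 : 0 < alpha by rewrite (lt_trans ltr01).
have NR0 : (0 : R) < N%:R by rewrite ltr0n.
have de0 : 0 < de by rewrite powR_gt0.
have f0 : 0 <= f := rnorm_ge0 _; have h0 : 0 <= h := rnorm_ge0 _.
have d0 : 0 <= d := rnorm_ge0 _.
have CN0 : 0 <= C * N%:R by rewrite mulr_ge0 ?(le_trans ler01 C1)// ltW.
rewrite mulrDr; have [dde|ded] := leP d de.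
  rewrite ler_wpDr ?mulr_ge0 ?exprn_ge0 ?(ltW de0)//.
  by rewrite ler_wpM2r// lerXn2r ?nnegrE ?(ltW de0).
rewrite ler_wpDl ?mulr_ge0 ?exprn_ge0 ?(ltW de0)//.
have deN : de `^ alpha * N%:R = 1.
  by rewrite -powRrM mulNr mulVf ?gt_eqF// powR_inv1 ?(ltW NR0)// mulVf// gt_eqF.
have dle : d <= d `^ alpha * (de * N%:R).
  have pE (y : R) : 0 < y -> y `^ alpha = y * y `^ (alpha - 1).
    move=> y0; rewrite -{2}[y]powRr1 ?(ltW y0)// -powRD; first by rewrite addrC subrK.
    by rewrite (gt_eqF y0) implybT.
  have d00 : 0 < d := lt_trans de0 ded.
  rewrite (pE d)// -mulrA ler_peMr// -[leLHS]deN (pE de)// mulrAC mulrC ler_wpM2r//.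
    by rewrite mulr_ge0// ltW.
  by rewrite ge0_ler_powR ?nnegrE ?(ltW de0) ?(ltW ded)// subr_ge0 ltW.
have := Ritt_iter i (act T w (window R N k i) x) w1.
have dE : rnorm (1 - w) = d by rewrite -rnormN opprB.
rewrite -actM window_factor// -/f -/h dE => hR.
apply: le_trans (_ : (d `^ alpha * (de * N%:R)) ^+ i * f <= _).
  by rewrite ler_wpM2r// lerXn2r ?nnegrE ?mulr_ge0 ?powR_ge0 ?(ltW de0) ?(ltW NR0).
have -> : (d `^ alpha * (de * N%:R)) ^+ i * f =
  (de ^+ i * N%:R ^+ i) * ((d `^ alpha) ^+ i * f) by rewrite !exprMn; ring.
have -> : de ^+ i * ((C * N%:R) ^+ i * h) = (de ^+ i * N%:R ^+ i) * (C ^+ i * h).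
  by rewrite exprMn; ring.
by rewrite ler_wpM2l// mulr_ge0 ?exprn_ge0 ?(ltW de0) ?(ltW NR0).
Qed.
(** In the [i]-th term of the expansion, [|w - 1|^i] gains [de ^+ i]. Window [i], as well as
    [(C * N%:R) ^+ i] times window 0, has size of order [N ^ i]. Here [M] is large enough for every
    window to satisfy Parseval. *)
Lemma sum_act_defect_le k N M z L x : (0 < N)%N -> M = (k.+1 * N).+1 ->
  M.-primitive_root z -> 0 <= L ->
  (forall j y, (j < M)%N -> rnorm (iter j T y) <= L * rnorm y) ->
  \sum_(t < M) rnorm (act T (z ^+ t) (geosum R N ^+ k.+1) (iter k defect x)) ^+ 2
  <= k.+1%:R * \sum_(i < k.+1) (2 * 'C(k, i)%:R * 2 ^+ k * C ^+ k) ^+ 2 *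
     (M%:R * L * rnorm x * (N%:R `^ (- alpha^-1) * N%:R) ^+ k) ^+ 2.
Proof.
move=> N0 ME zM L0 TL; set de := _ `^ _.
have NR1 : (1 : R) <= N%:R by rewrite ler1n.
have NR0 : (0 : R) < N%:R by rewrite ltr0n.
have de0 : 0 < de by rewrite powR_gt0.
have C0 : 0 <= C := le_trans ler01 C1.
have X0 : 0 <= rnorm x := rnorm_ge0 x.
(* As [alpha > 1], the worst term of the expansion is [i = k]. *)
have deN1 : 1 <= de * N%:R.
  rewrite -[X in _ * X]powRr1 ?(ltW NR0)// -powRD; last by rewrite (gt_eqF NR0) implybT.
  rewrite -[leLHS](powRr0 (N%:R : R)) ler_powR// addrC subr_ge0 invf_le1 ?(lt_trans ltr01)//.
  exact: ltW.
pose f i t := rnorm (act T (z ^+ t) (window R N k i) x).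
have f0 i t : 0 <= f i t := rnorm_ge0 _.
pose b i t := 'C(k, i)%:R * (de ^+ i * (f i t + (C * N%:R) ^+ i * f 0%N t)).
have fS i : (i <= k)%N -> \sum_(t < M) f i t ^+ 2 <=
    (M%:R * (2 ^+ k * N%:R ^+ i) * L * rnorm x) ^+ 2.
  move=> ik; apply: sum_act_norm_le => //.
  - by rewrite ME size_window.
  - move=> j; rewrite (le_trans (coef_bounded_window R N k i j))//.
    by rewrite ler_wpM2r ?exprn_ge0// ler_weXn2l ?leq_subr// ler1n.
  - by move=> j; exact: TL.
have zt (t : nat) : rnorm (z ^+ t) = 1 by rewrite rnormX (rnorm_prim_root zM) expr1n.
have fb (t : 'I_M) : rnorm (act T (z ^+ t) (geosum R N ^+ k.+1) (iter k defect x))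
    <= \sum_(i < k.+1) b i t.
  rewrite act_iter_defect -[leLHS]mul1r -[X in X * _](expr1n _ k) -(zt t).
  rewrite -rnormX -rnormZ iter_defect_expand (le_trans (ler_rnorm_sum _ _ _))//.
  apply: ler_sum => i _; have ik : (i <= k)%N by rewrite -ltnS.
  rewrite -actM geosum_window// rnormZ rnormM rnorm_nat rnormX -mulrA.
  by rewrite ler_wpM2l// near_far_le.
apply: le_trans (_ : \sum_(t < M) k.+1%:R * \sum_(i < k.+1) b i t ^+ 2 <= _).
  apply: ler_sum => t _; apply: le_trans (_ : (\sum_(i < k.+1) b i t) ^+ 2 <= _).
    by rewrite lerXn2r ?nnegrE ?rnorm_ge0// (le_trans (rnorm_ge0 _) (fb t)).
  exact: (sqr_sum_le _ (fun i => b i t)).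
rewrite -mulr_sumr ler_wpM2l// exchange_big /=; apply: ler_sum => i _.
have ik : (i <= k)%N by rewrite -ltnS.
pose S := M%:R * L * rnorm x * 2 ^+ k.
have S0 : 0 <= S by rewrite !mulr_ge0// exprn_ge0.
have CiC : C ^+ i <= C ^+ k by rewrite ler_weXn2l.
have Ci1 : 1 <= C ^+ i by rewrite exprn_ege1.
apply: le_trans (_ : 'C(k, i)%:R ^+ 2 * ((de ^+ i) ^+ 2 *
   (2 * (S * N%:R ^+ i) ^+ 2 + 2 * (((C * N%:R) ^+ i) ^+ 2 * S ^+ 2))) <= _).
  apply: le_trans (_ : \sum_(t < M) 'C(k, i)%:R ^+ 2 * ((de ^+ i) ^+ 2 *
     (2 * f i t ^+ 2 + 2 * (((C * N%:R) ^+ i) ^+ 2 * f 0%N t ^+ 2))) <= _).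
    apply: ler_sum => t _; rewrite /b; set c := (C * _) ^+ i.
    rewrite exprMn ler_wpM2l ?sqr_ge0// exprMn ler_wpM2l ?sqr_ge0//.
    by have := sqr_ge0 (f i t - c * f 0%N t); rewrite sqrrB sqrrD exprMn; lra.
  rewrite -mulr_sumr ler_wpM2l ?sqr_ge0// -mulr_sumr ler_wpM2l ?sqr_ge0//.
  rewrite big_split /= -!mulr_sumr lerD// ler_wpM2l//.
    apply: le_trans (fS i ik) _; rewrite le_eqVlt; apply/orP; left; apply/eqP.
    by rewrite /S; congr (_ ^+ 2); ring.
  rewrite ler_wpM2l ?sqr_ge0//; apply: le_trans (fS 0%N (leq0n k)) _.
  by rewrite le_eqVlt; apply/orP; left; apply/eqP; rewrite /S; congr (_ ^+ 2); ring.
have -> : (2 * 'C(k, i)%:R * 2 ^+ k * C ^+ k) ^+ 2 *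
     (M%:R * L * rnorm x * (de * N%:R) ^+ k) ^+ 2 = 'C(k, i)%:R ^+ 2 *
   (4 * (S * (C ^+ k * (de * N%:R) ^+ k)) ^+ 2) by rewrite /S; ring.
rewrite ler_wpM2l ?sqr_ge0//.
have -> : (de ^+ i) ^+ 2 *
   (2 * (S * N%:R ^+ i) ^+ 2 + 2 * (((C * N%:R) ^+ i) ^+ 2 * S ^+ 2)) =
   2 * (S * (1 * (de * N%:R) ^+ i)) ^+ 2 + 2 * (S * (C ^+ i * (de * N%:R) ^+ i)) ^+ 2.
  by rewrite !exprMn; ring.
have key c : 0 <= c -> c <= C ^+ k ->
    (S * (c * (de * N%:R) ^+ i)) ^+ 2 <= (S * (C ^+ k * (de * N%:R) ^+ k)) ^+ 2.
  move=> c0 cC; have dN0 : 0 <= de * N%:R := le_trans ler01 deN1.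
  have h0 : 0 <= c * (de * N%:R) ^+ i by rewrite mulr_ge0// exprn_ge0.
  have hle : c * (de * N%:R) ^+ i <= C ^+ k * (de * N%:R) ^+ k.
    by apply: ler_pM; rewrite ?exprn_ge0// ler_weXn2l.
  rewrite lerXn2r ?nnegrE ?(mulr_ge0 S0 h0) ?(mulr_ge0 S0 (le_trans h0 hle))//.
  by rewrite ler_wpM2l.
have := key 1 ler01 (le_trans Ci1 CiC); have := key _ (le_trans ler01 Ci1) CiC.
lra.
Qed.

(** Averaging [T^(n-j) (T^j y) = T^n y] with the weights [g_j] uses one factor [L] for [T^(n-j)];
    the mean-square bound supplies the other factor [L]. *)
Lemma defect_power_le k : exists2 G : R, 0 <= G & forall N n L x, (0 < N)%N ->
  (k.+1 * N.-1 <= n)%N -> (n < k.+1 * N)%N -> 0 <= L ->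
  (forall j y, (j <= k.+1 * N)%N -> rnorm (iter j T y) <= L * rnorm y) ->
  rnorm (iter n T (iter k defect x)) <=
    G * L ^+ 2 * (N%:R `^ (- alpha^-1)) ^+ k * rnorm x.
Proof.
pose G0 : R := k.+1%:R * \sum_(i < k.+1) (2 * 'C(k, i)%:R * 2 ^+ k * C ^+ k) ^+ 2.
have G00 : 0 <= G0 by rewrite mulr_ge0// sumr_ge0// => i _; rewrite sqr_ge0.
(* [1 + G0] dominates the square root of [G0], and [k.+2] comes from [M <= k.+2 * N]. *)
exists ((1 + G0) * k.+2%:R); first by rewrite mulr_ge0// addr_ge0.
move=> N n L x N0 kn nk L0 TL; set de := _ `^ _; set y := iter k defect x.
pose M := (k.+1 * N).+1; have M0 : (0 < M)%N by [].
have [z zM] := prim_root_exists R[i] M0.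
have NR0 : (0 : R) < N%:R by rewrite ltr0n.
have de0 : 0 < de by rewrite powR_gt0.
have MR0 : (0 : R) < M%:R by rewrite ltr0n.
have X0 : 0 <= rnorm x := rnorm_ge0 x.
pose g := geosum R N ^+ k.+1.
have gn : (size g <= n.+1)%N by rewrite (leq_trans (size_geosumX R k.+1 N0)).
have nM : (n.+1 <= M)%N by rewrite ltnW.
have := sum_act_defect_le x N0 (erefl M) zM L0 TL.
rewrite -/y -/g (parseval_act _ zM (leq_trans gn nM)) -mulr_suml mulrA -/G0.
set Q := \sum_(j < M) _ => hQ.
have TnE : N%:R ^+ k.+1 *: iter n T y =
    \sum_(j < n.+1) iter (n - j) T ((g`_j)%:C *: iter j T y).
  have -> : (N%:R : R[i]) ^+ k.+1 = (\sum_(j < n.+1) g`_j)%:C.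
    by rewrite sum_coef_geosumX// rmorphXn /= (rmorph_nat (real_complex R)).
  rewrite rmorph_sum scaler_suml; apply: eq_bigr => j _.
  by rewrite iterZl -iterD subnK// -ltnS.
have : (N%:R ^+ k.+1 * rnorm (iter n T y)) ^+ 2 <=
    ((1 + G0) * L * (M%:R * L * rnorm x * (de * N%:R) ^+ k)) ^+ 2.
  have -> : N%:R ^+ k.+1 * rnorm (iter n T y) =
      rnorm (\sum_(j < n.+1) iter (n - j) T ((g`_j)%:C *: iter j T y)).
    by rewrite -TnE rnormZ rnormX rnorm_nat.
  apply: le_trans (_ : (\sum_(j < n.+1) L * (`|g`_j| * rnorm (iter j T y))) ^+ 2 <= _).
    rewrite lerXn2r ?nnegrE ?rnorm_ge0 ?sumr_ge0// => [j _|].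
      by rewrite !mulr_ge0 ?rnorm_ge0.
    rewrite (le_trans (ler_rnorm_sum _ _ _))//; apply: ler_sum => j _.
    rewrite (le_trans (TL _ _ _)) ?rnormZ ?rnorm_real//.
    by rewrite (leq_trans (leq_subr _ _))// ltnW.
  apply: le_trans (sqr_sum_le _ (fun j => L * (`|g`_j| * rnorm (iter j T y)))) _.
  (* Cauchy-Schwarz costs [n.+1 <= M], and [M%:R * Q] is exactly what Parseval controls. *)
  apply: le_trans (_ : M%:R * (L ^+ 2 * Q) <= _).
    apply: ler_pM => //; rewrite ?ler_nat//; first by rewrite sumr_ge0// => j _; rewrite sqr_ge0.
    under eq_bigr do rewrite exprMn; rewrite -mulr_sumr ler_wpM2l ?sqr_ge0//.
    rewrite -(big_mkord xpredT (fun j => (`|g`_j| * rnorm (iter j T y)) ^+ 2)).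
    by apply: sum_nat_subrange => // j; rewrite sqr_ge0.
  rewrite mulrCA; apply: le_trans (ler_wpM2l (sqr_ge0 L) hQ) _.
  set U := M%:R * L * _ * _; have -> : ((1 + G0) * L * U) ^+ 2 =
     L ^+ 2 * ((1 + G0) ^+ 2 * U ^+ 2) by ring.
  rewrite ler_wpM2l ?sqr_ge0// ler_wpM2r ?sqr_ge0//.
  by have := sqr_ge0 G0; rewrite sqrrD; lra.
have G1 : 0 <= 1 + G0 by rewrite addr_ge0.
have dk0 : 0 <= de ^+ k by rewrite exprn_ge0// ltW.
have Nk : (0 : R) < N%:R ^+ k by rewrite exprn_gt0.
rewrite ler_pXn2r ?nnegrE ?mulr_ge0 ?rnorm_ge0 ?exprn_ge0 ?(mulr_ge0 (ltW de0) (ltW NR0))// => h.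
have NkS : (0 : R) < N%:R ^+ k.+1 by rewrite exprn_gt0.
rewrite -(ler_pM2l NkS) (le_trans h)//.
have -> : (1 + G0) * L * (M%:R * L * rnorm x * (de * N%:R) ^+ k) =
  ((1 + G0) * L ^+ 2 * rnorm x * de ^+ k * N%:R ^+ k) * M%:R by rewrite exprMn; ring.
have -> : N%:R ^+ k.+1 * ((1 + G0) * k.+2%:R * L ^+ 2 * de ^+ k * rnorm x) =
  ((1 + G0) * L ^+ 2 * rnorm x * de ^+ k * N%:R ^+ k) * (k.+2%:R * N%:R).
  by rewrite exprS; ring.
rewrite ler_wpM2l//; first by rewrite !mulr_ge0 ?exprn_ge0// ltW.
by rewrite -natrM ler_nat /M mulSn -addn1 addnC leq_add.
Qed.
End Decay.

(** * Choice of the window length *)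

(** Serves to bound the logarithm of a multiple of [n] by a multiple of [ln n.+1]. *)
Lemma mul_lt_expnS m n : (m * n < n.+1 ^ m)%N.
Proof.
elim: m => [|m IH]; first by rewrite mul0n expn0.
by rewrite expnS !mulSn [(n + _)%N]addnC -addSn leq_add// leq_pmulr// expn_gt0.
Qed.

Theorem theorem2p5 (R : realType) (alpha : R) (alpha_gt1 : 1 < alpha)
    (H : completeNormedModType R[i]) (dot : {dot H for Num.conj})
    (dotE : forall x : H, `|x| ^+ 2 = dot x x)
    (T : {linear H -> H}) (T_bounded : bounded_near T (nbhs (0 : H)))
    (T_Ritt : alpha_Ritt alpha T) (T_Kreiss : strongly_Kreiss_bounded T) :
  exists2 kappa : R, 0 < kappa &
    forall k : nat, (0 < k)%N ->
      seq_bigO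
        (fun n => opnorm (iter n T \o iter k (fun x => x - T x)))
        (fun n => ln (n.+1)%:R `^ kappa / n%:R `^ (k%:R / alpha)).
Proof.
have [K K0 TK] := linear_rnorm_bound T_bounded.
have K1 : 1 <= K + 1 by rewrite lerDr ltW.
have TK1 x : rnorm (T x) <= (K + 1) * rnorm x.
  by rewrite (le_trans (TK x))// ler_wpM2r ?rnorm_ge0// lerDl.
have [C C1 TC] := Kreiss_apriori T_Kreiss.
have A1 : 1 <= 2 * C by lra.
have [D D0 [kappa kappa0 TD]] :=
  power_growth dotE A1 (kernel_exists K0 TK C1 TC) K1 TK1.
have [C' C'1 TC'] := Ritt_apriori alpha_gt1 T_Ritt.
(* The growth bound enters squared, whatever [k] is. *)
exists (2 * kappa)%:R => [|k _]; first by rewrite ltr0n muln_gt0.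
have [G G0 TG] := defect_power_le dotE alpha_gt1 C'1 TC' k.
have a0 : 0 < alpha := lt_trans ltr01 alpha_gt1.
(* The factor in [k + 5] compares the logarithm at [k.+1 * N + 4] with [ln n.+1]; the last factor
   compares [N] with [n]. *)
pose c := G * D ^+ 2 * (k + 5)%:R ^+ (2 * kappa) * k.+1%:R ^+ k.
have c0 : 0 <= c by rewrite !mulr_ge0 ?exprn_ge0// ltW.
exists (c + 1) => [|n n0]; first by rewrite ltr_wpDl.
have ln0 m : 0 <= ln (m.+1%:R : R) by rewrite ln_ge0// ler1n.
rewrite powR_mulrn//; set l := ln _ ^+ _; set p := _ `^ (k%:R / alpha).
have l0 : 0 <= l by rewrite exprn_ge0.
have nR0 : (0 : R) < n%:R by rewrite ltr0n.
have p0 : 0 < p by rewrite powR_gt0.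
(* The least [N] with [n < k.+1 * N]; then the degree [k.+1 * N.-1] of the weights is at most
   [n]. *)
pose N := (n %/ k.+1).+1.
have kN : (k.+1 * N.-1 <= n)%N by rewrite mulnC leq_trunc_div.
have Nk : (n < k.+1 * N)%N by rewrite mulnC ltn_ceil.
have NR0 : (0 : R) < N%:R by rewrite ltr0n.
pose L := D * ln (k.+1 * N).+4%:R ^+ kappa.
have L0 : 0 <= L by rewrite mulr_ge0 ?exprn_ge0// ltW.
have TL j y : (j <= k.+1 * N)%N -> rnorm (iter j T y) <= L * rnorm y.
  move=> jN; rewrite (le_trans (TD j y))// ler_wpM2r ?rnorm_ge0// ler_wpM2l ?(ltW D0)//.
  by rewrite lerXn2r ?nnegrE// ler_ln ?posrE ?ltr0n// ler_nat.
apply: le_trans (_ : G * L ^+ 2 * (N%:R `^ (- alpha^-1)) ^+ k <= _).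
  apply: opnorm_le.
    exact: mulr_ge0 (mulr_ge0 G0 (sqr_ge0 L)) (exprn_ge0 _ (powR_ge0 _ _)).
  by move=> x; apply: (TG N n L x).
have Ll : L ^+ 2 <= D ^+ 2 * (k + 5)%:R ^+ (2 * kappa) * l.
  rewrite /L exprMn -[leRHS]mulrA ler_wpM2l ?sqr_ge0// -exprM [(kappa * 2)%N]mulnC.
  rewrite /l -exprMn lerXn2r ?nnegrE ?mulr_ge0//.
  rewrite mulr_natl -lnXn ?ltr0n// ler_ln ?posrE ?exprn_gt0 ?ltr0n//.
  rewrite -natrX ler_nat (leq_trans _ (mul_lt_expnS _ _))//.
  have -> : (k.+1 * N = k.+1 * N.-1 + k.+1)%N by rewrite mulnS addnC.
  have kkn : (k <= k * n)%N by rewrite leq_pmulr.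
  have -> : ((k + 5) * n = k * n + 5 * n)%N by rewrite mulnDl.
  by move: (k.+1 * N.-1)%N (k * n)%N kN kkn => a b; clear -n0; lia.
have dp : (N%:R `^ (- alpha^-1)) ^+ k <= k.+1%:R ^+ k / p.
  rewrite ler_pdivlMr//.
  have -> : (N%:R `^ (- alpha^-1)) ^+ k = (N%:R `^ (k%:R / alpha))^-1.
    by rewrite -powR_mulrn ?powR_ge0// -powRrM mulNr powRN mulrC.
  have pN : 0 < (N%:R : R) `^ (k%:R / alpha) by rewrite powR_gt0.
  rewrite mulrC ler_pdivrMr//.
  have ka : 0 <= k%:R / alpha by rewrite divr_ge0// ltW.
  apply: le_trans (_ : (k.+1%:R * N%:R) `^ (k%:R / alpha) <= _).
    have nkN : n%:R <= k.+1%:R * N%:R :> R by rewrite -natrM ler_nat ltnW.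
    by rewrite (ge0_ler_powR ka) ?nnegrE ?mulr_ge0.
  rewrite powRM// ler_wpM2r ?(ltW pN)// -powR_mulrn// ler_powR ?ler1n//.
  by rewrite ler_pdivrMr// ler_peMr// ltW.
apply: le_trans (_ : c * (l / p) <= _).
  have -> : c * (l / p) = G * (D ^+ 2 * (k + 5)%:R ^+ (2 * kappa) * l) *
      (k.+1%:R ^+ k / p) by rewrite /c; ring.
  apply: ler_pM _ _ (ler_wpM2l G0 Ll) dp.
    exact: mulr_ge0 G0 (sqr_ge0 L).
  exact: exprn_ge0 (powR_ge0 _ _).
by rewrite ler_wpM2r ?lerDl// divr_ge0// ltW.
Qed.
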